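(* Let $0<\varepsilon<1$ and let $F_\varepsilon$ be the Katok--Ziller metric on the torus $\mathbb{T}^2=\mathbb{R}^2/\mathbb{Z}^2$ with coordinates $(x,y)$ given by $$F_\varepsilon(x,y;\xi_x,\xi_y)=\frac{1}{1-\varepsilon^2}\left(\sqrt{\xi_x^2+(1-\varepsilon^2)\xi_y^2}-\varepsilon\,\xi_x\right).$$ Then the Finsler--Laplace operator of $(\mathbb{T}^2,F_\varepsilon)$ is $$\Delta^{F_\varepsilon}=\frac{2(1-\varepsilon^2)}{1+\sqrt{1-\varepsilon^2}}\left(\sqrt{1-\varepsilon^2}\,\frac{\partial^2}{\partial x^2}+\frac{\partial^2}{\partial y^2}\right),$$ and the spectrum of $-\Delta^{F_\varepsilon}$ is the set of the numbers $$\lambda_{(p,q)}=4\pi^2\,\frac{2(1-\varepsilon^2)}{1+\sqrt{1-\varepsilon^2}}\left(\sqrt{1-\varepsilon^2}\,p^2+q^2\right),\qquad (p,q)\in\mathbb{Z}^2.$$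
   Context: $(\xi_x,\xi_y)$ are the coordinates on tangent spaces associated with $(x,y)$. For a Finsler metric $F$ on an oriented $n$-manifold $M$ (continuous $F\colon TM\to[0,\infty)$, smooth off the zero section, positively homogeneous of degree one, positive-definite, strongly convex): $HM:=(TM\smallsetminus\{\text{zero section}\})/\mathbb{R}^+$, with quotient map $r\colon TM\smallsetminus 0\to HM$, projection $\pi\colon HM\to M$, fibers $H_xM$, vertical bundle $VHM=\ker d\pi$. The Hilbert form is the contact 1-form $A$ on $HM$ with $r^*A=\frac{\partial F}{\partial v^i}dx^i$; its Reeb field $X$ satisfies $A(X)=1$, $i_XdA=0$. $HM$ is oriented by $A\wedge dA^{n-1}$ and the fibers $H_xM$ so that fiber orientation followed by base orientation is that of $HM$. There is a unique volume form $\Omega^F$ on $M$ for which there is an $(n-1)$-form $\alpha^F$ on $HM$, nowhere zero on $VHM$ (and uniquely determined there), with $\alpha^F\wedge\pi^*\Omega^F=A\wedge dA^{n-1}$ and $\int_{H_xM}\alpha^F=\mathrm{vol}_{\mathrm{Eucl}}(\mathbb{S}^{n-1})$ for all $x$. The Finsler--Laplace operator is $\Delta^Ff(x)=\frac{n}{\mathrm{vol}_{\mathrm{Eucl}}(\mathbb{S}^{n-1})}\int_{H_xM}L_X^2(\pi^*f)\,\alpha^F$. Here $n=2$ and $M=\mathbb{T}^2$. Spectrum: the set of $\lambda$ for which $\Delta^{F_\varepsilon}f+\lambda f=0$ has a nonzero solution $f\in C^\infty(\mathbb{T}^2)$. *)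

(* Defs.v *)
From Stdlib Require Export Reals List ClassicalEpsilon.
From Coquelicot Require Export Coquelicot.
Open Scope R_scope.

(* Derivative of f at p in the direction v. *)
Definition D {V : NormedModule R_AbsRing} (v : V) (f : V -> R) (p : V) : R :=
  Derive (fun s : R => f (plus p (scal s v))) 0.

Definition iterD {V : NormedModule R_AbsRing} (vs : list V) (f : V -> R) : V -> R :=
  fold_right D f vs.

(* C^infinity on the open subset U of the (finite-dimensional) space V: all
   iterated directional derivatives exist and are continuous on U. *)
Definition smooth_on {V : NormedModule R_AbsRing} (U : V -> Prop) (f : V -> R) : Prop :=
  forall (vs : list V) (p : V), U p ->
    continuous (iterD vs f) p /\
    forall v : V, ex_derive (fun s : R => iterD vs f (plus p (scal s v))) 0.

Definition smooth {V : NormedModule R_AbsRing} (f : V -> R) : Prop :=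
  smooth_on (fun _ => True) f.

(* Objects on T^2 are Z^2-periodic objects on R^2, oriented by dx /\ dy; its
   tangent bundle is T^2 x R^2. *)
Definition torus_periodic {T : Type} (f : R * R -> T) : Prop :=
  forall x y : R, f (x + 1, y) = f (x, y) /\ f (x, y + 1) = f (x, y).

Definition torus_smooth (f : R * R -> R) : Prop := torus_periodic f /\ smooth f.

Definition e1 : R * R := (1, 0).
Definition e2 : R * R := (0, 1).

(* F p v is the norm of the tangent vector v at p. *)
Definition metric : Type := R * R -> R * R -> R.

(* Coefficients d^2(F^2/2) / dv^i dv^j at (p, v), for basis vectors ei, ej. *)
Definition fundamental_tensor (F : metric) (ei ej p v : R * R) : R :=
  D ei (D ej (fun w => F p w ^ 2 / 2)) v.

Definition strongly_convex (F : metric) : Prop :=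
  forall p v : R * R, v <> (0, 0) ->
  forall w1 w2 : R, (w1, w2) <> (0, 0) ->
    0 < fundamental_tensor F e1 e1 p v * w1 * w1
        + fundamental_tensor F e1 e2 p v * w1 * w2
        + fundamental_tensor F e2 e1 p v * w2 * w1
        + fundamental_tensor F e2 e2 p v * w2 * w2.

Record is_finsler (F : metric) : Prop := {
  finsler_periodic : forall v : R * R, torus_periodic (fun p => F p v);
  finsler_continuous :
    forall q : R * R * (R * R), continuous (fun q => F (fst q) (snd q)) q;
  finsler_smooth :
    smooth_on (fun q : R * R * (R * R) => snd q <> (0, 0))
      (fun q => F (fst q) (snd q));
  finsler_homogeneous : forall (p : R * R) (c v1 v2 : R), 0 < c ->
    F p (c * v1, c * v2) = c * F p (v1, v2);
  finsler_nonneg : forall p v : R * R, 0 <= F p v;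
  finsler_definite : forall p v : R * R, F p v = 0 <-> v = (0, 0);
  finsler_convex : strongly_convex F
}.

(* (p, t) in R^2 x R stands for the ray of (cos t, sin t) at p; this
   identifies HM with (R/Z)^2 x R/(2 PI Z).  The projection pi forgets t. *)
Definition hm_smooth (g : R * R * R -> R) : Prop :=
  (forall t : R, torus_periodic (fun p => g (p, t))) /\
  (forall (p : R * R) (t : R), g (p, t + 2 * PI) = g (p, t)) /\
  smooth g.

Definition u_x : R * R * R := (1, 0, 0).
Definition u_y : R * R * R := (0, 1, 0).
Definition u_t : R * R * R := (0, 0, 1).

(* a_x dx + a_y dy + a_t dt *)
Record form1 : Type := Form1 { a_x : R * R * R -> R;
                               a_y : R * R * R -> R;
                               a_t : R * R * R -> R }.

(* w_xy dx/\dy + w_xt dx/\dt + w_yt dy/\dt *)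
Record form2 : Type := Form2 { w_xy : R * R * R -> R;
                               w_xt : R * R * R -> R;
                               w_yt : R * R * R -> R }.

(* X_x d/dx + X_y d/dy + X_t d/dt *)
Record vfield : Type := VField { X_x : R * R * R -> R;
                                 X_y : R * R * R -> R;
                                 X_t : R * R * R -> R }.

Definition form1_smooth (A : form1) : Prop :=
  hm_smooth (a_x A) /\ hm_smooth (a_y A) /\ hm_smooth (a_t A).

Definition vfield_smooth (X : vfield) : Prop :=
  hm_smooth (X_x X) /\ hm_smooth (X_y X) /\ hm_smooth (X_t X).

Definition ext_d (A : form1) : form2 :=
  Form2 (fun q => D u_x (a_y A) q - D u_y (a_x A) q)
        (fun q => D u_x (a_t A) q - D u_t (a_x A) q)
        (fun q => D u_y (a_t A) q - D u_t (a_y A) q).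

Definition pairing (A : form1) (X : vfield) (q : R * R * R) : R :=
  a_x A q * X_x X q + a_y A q * X_y X q + a_t A q * X_t X q.

(* i_X w = w(X, .) *)
Definition interior (X : vfield) (w : form2) : form1 :=
  Form1 (fun q => - X_y X q * w_xy w q - X_t X q * w_xt w q)
        (fun q => X_x X q * w_xy w q - X_t X q * w_yt w q)
        (fun q => X_x X q * w_xt w q + X_y X q * w_yt w q).

(* Coefficient of A /\ w on dx/\dy/\dt = dt/\dx/\dy. *)
Definition wedge (A : form1) (w : form2) (q : R * R * R) : R :=
  a_x A q * w_yt w q - a_y A q * w_xt w q + a_t A q * w_xy w q.

Definition scale_form (g : R * R * R -> R) (A : form1) : form1 :=
  Form1 (fun q => g q * a_x A q) (fun q => g q * a_y A q) (fun q => g q * a_t A q).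

Definition lie (X : vfield) (g : R * R * R -> R) (q : R * R * R) : R :=
  X_x X q * D u_x g q + X_y X q * D u_y g q + X_t X q * D u_t g q.

Definition pull_fun (f : R * R -> R) (q : R * R * R) : R := f (fst q).

(* pi^* (omega dx/\dy) *)
Definition pull_area (omega : R * R -> R) : form2 :=
  Form2 (fun q => omega (fst q)) (fun _ => 0) (fun _ => 0).

(* In polar coordinates (p, rho, t) on TM minus the zero section, r is
   (p, rho, t) |-> (p, t), so r^*A has the coefficients of A; they must agree
   with those of dF/dv^i dx^i at the vector (rho cos t, rho sin t). *)
Definition is_hilbert_form (F : metric) (A : form1) : Prop :=
  form1_smooth A /\
  (forall q, wedge A (ext_d A) q <> 0) /\
  forall (p : R * R) (rho t : R), 0 < rho ->
    a_x A (p, t) = D e1 (F p) (rho * cos t, rho * sin t) /\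
    a_y A (p, t) = D e2 (F p) (rho * cos t, rho * sin t) /\
    a_t A (p, t) = 0.

Definition is_reeb_field (A : form1) (X : vfield) : Prop :=
  vfield_smooth X /\
  forall q, pairing A X q = 1 /\
    a_x (interior X (ext_d A)) q = 0 /\
    a_y (interior X (ext_d A)) q = 0 /\
    a_t (interior X (ext_d A)) q = 0.

(* Integral of beta over the fiber of HM at p.  HM is oriented by A /\ dA and
   fiber orientation followed by dx /\ dy must be that of HM, so d/dt is
   positive on the fiber exactly when A /\ dA is a positive multiple of
   dt/\dx/\dy. *)
Definition fiber_integral (A beta : form1) (p : R * R) : R :=
  RInt (fun t => sign (wedge A (ext_d A) (p, t)) * a_t beta (p, t)) 0 (2 * PI).

Definition vol_S1 : R := 2 * PI.

(* The pair (alpha^F, omega), where Omega^F = omega dx/\dy; alpha^F is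
   determined on the vertical bundle only. *)
Definition is_angle_volume (A : form1) (ao : form1 * (R * R -> R)) : Prop :=
  let (alpha, omega) := ao in
  form1_smooth alpha /\ torus_smooth omega /\
  (forall p, omega p <> 0) /\
  (forall q, a_t alpha q <> 0) /\
  (forall q, wedge alpha (pull_area omega) q = wedge A (ext_d A) q) /\
  (forall p, fiber_integral A alpha p = vol_S1).

Definition zero_fun (q : R * R * R) : R := 0.

Definition hilbert_form (F : metric) : form1 :=
  epsilon (inhabits (Form1 zero_fun zero_fun zero_fun)) (is_hilbert_form F).

Definition reeb_field (F : metric) : vfield :=
  epsilon (inhabits (VField zero_fun zero_fun zero_fun))
    (is_reeb_field (hilbert_form F)).

Definition angle_volume (F : metric) : form1 * (R * R -> R) :=
  epsilon (inhabits (Form1 zero_fun zero_fun zero_fun, fun _ => 0))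
    (is_angle_volume (hilbert_form F)).

Definition angle_form (F : metric) : form1 := fst (angle_volume F).

Definition finsler_laplace (F : metric) (f : R * R -> R) (p : R * R) : R :=
  2 / vol_S1 *
  fiber_integral (hilbert_form F)
    (scale_form (lie (reeb_field F) (lie (reeb_field F) (pull_fun f)))
       (angle_form F)) p.

(* The spectrum of - Delta^F, with real-valued eigenfunctions. *)
Definition spectrum (F : metric) (lambda : R) : Prop :=
  exists f : R * R -> R,
    torus_smooth f /\ (exists p, f p <> 0) /\
    forall p, finsler_laplace F f p + lambda * f p = 0.

Definition katok_ziller (eps : R) : metric := fun _ xi =>
  / (1 - eps ^ 2)
  * (sqrt (fst xi ^ 2 + (1 - eps ^ 2) * snd xi ^ 2) - eps * fst xi).

(* Main.v *)
Require Import Defs.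
From Stdlib Require Import ZArith Lra Lia FunctionalExtensionality.

(** Write [F] for the metric, [k = 1 - eps ^ 2], [m = sqrt k], and for a unit
    vector [(cos t, sin t)] put [r = sqrt (cos t ^ 2 + k * sin t ^ 2)], so that
    [F = (r - eps * cos t) / k].  As [F] does not depend on the base point,
    everything reduces to calculus in the single variable [t].

    The Hessian of [F] at a vector [v] sends [w] to the square of the
    determinant of [v] and [w], divided by the cube of the Riemannian root.
    This gives strong convexity ([kz_strongly_convex]) and, along the unit
    circle, the derivatives [- sin t / r ^ 3] and [cos t / r ^ 3] of the
    coefficients of the Hilbert form [A].  Hence [A /\ dA] has coefficient
    [- F / r ^ 3] ([kz_hilbert_wedge]), the Reeb field is [(cos t, sin t, 0) / F]
    ([reeb_field_kz]), and since [F / r ^ 3] integrates to [2 * PI / m ^ 3] over the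
    fiber, the angle form is [- m ^ 3 * F / r ^ 3 dt] on the vertical bundle
    ([angle_form_kz]).  The defining conditions leave no other choice, which is
    what turns the objects picked by [epsilon] into these explicit ones.

    The Laplacian of [f] is therefore the integral over [t] of
    [m ^ 3 / (PI * r ^ 3 * F)] times the second derivative of [f] in the direction
    [(cos t, sin t)].  The identity [(r - eps * cos t) * (r + eps * cos t) = k]
    gives [1 / F = r + eps * cos t]: the dependence on the drift becomes a summand
    that is odd under a half turn and drops out.  What remains are the
    integrals of [cos ^ 2], [sin * cos] and [sin ^ 2] against [1 / r ^ 2], computed
    with a continuous branch of [atan (m * tan t)] ([is_RInt_kz_quadratic]).

    The resulting operator has constant coefficients and no mixed term, so
    cosine modes are eigenfunctions.  Conversely, a nonzero eigenfunction has a
    nonzero Fourier coefficient ([exists_nonzero_coef]); integrating by parts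
    against the corresponding mode ([partial_coef_D_x], [partial_coef_D_y])
    identifies the eigenvalue.  Completeness of the Fourier modes is proved on
    the circle by concentrating powers of a trigonometric polynomial
    ([coef_eq_zero_at_half_nonpos]). *)

(** * Elementary functions are smooth *)

(** The class is large enough to contain every explicit function whose
    smoothness is at stake and small enough that, by the differentiation rules, a directional
    derivative of a member agrees on [U] with another member; smoothness then
    follows by induction on the number of derivatives. *)
Inductive elementary {V : NormedModule R_AbsRing} (U : V -> Prop) : (V -> R) -> Prop :=
| elem_const (c : R) : elementary U (fun _ => c)
| elem_linear (l : V -> R) : is_linear l -> elementary U l
| elem_plus (f g : V -> R) :
    elementary U f -> elementary U g -> elementary U (fun p => f p + g p)
| elem_mult (f g : V -> R) :
    elementary U f -> elementary U g -> elementary U (fun p => f p * g p)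
| elem_inv (f : V -> R) :
    (forall p, U p -> f p <> 0) -> elementary U f -> elementary U (fun p => / f p)
| elem_sqrt (f : V -> R) :
    (forall p, U p -> 0 < f p) -> elementary U f -> elementary U (fun p => sqrt (f p))
| elem_cos (f : V -> R) : elementary U f -> elementary U (fun p => cos (f p))
| elem_sin (f : V -> R) : elementary U f -> elementary U (fun p => sin (f p))
| elem_ext (f g : V -> R) :
    (forall p, U p -> f p = g p) -> elementary U f -> elementary U g.

Lemma scal_zero_plus {V : NormedModule R_AbsRing} (p v : V) :
  plus p (scal (0 : R) v) = p.
Proof.
  transitivity (plus p zero); [|apply plus_zero_r].
  f_equal. apply (scal_zero_l (K := R_AbsRing) v).
Qed.

Lemma line_in_open {V : NormedModule R_AbsRing} (U : V -> Prop) (p v : V) :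
  open U -> U p -> locally (0 : R) (fun s : R => U (plus p (scal s v))).
Proof.
  intros HU Hp.
  assert (Hc : continuous (fun s : R => plus p (scal s v)) (0 : R)).
  { apply @continuous_plus; [apply continuous_const|].
    apply (continuous_scal_l (fun s : R => s)), continuous_id. }
  apply Hc. rewrite scal_zero_plus. now apply HU.
Qed.

(** Membership of the derivative in the class is what allows iteration.  The
    case [elem_ext] is where [U] has to be open: two functions that agree on
    [U] must agree on a neighbourhood of each point along every line. *)
Lemma elementary_derivative {V : NormedModule R_AbsRing} (U : V -> Prop) (f : V -> R) :
  open U -> elementary U f ->
  (forall p, U p -> continuous f p) /\
  forall v, exists g, elementary U g /\
    forall p, U p -> is_derive (fun s : R => f (plus p (scal s v))) 0 (g p).
Proof.
  intros HU Hf.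
  induction Hf as [c | l Hl | f g Hf [Cf Df] Hg [Cg Dg] | f g Hf [Cf Df] Hg [Cg Dg]
    | f Hn Hf [Cf Df] | f Hn Hf [Cf Df] | f Hf [Cf Df] | f Hf [Cf Df]
    | f g He Hf [Cf Df]]; split.
  - intros p _. apply continuous_const.
  - intros v. exists (fun _ => 0). split; [apply elem_const|].
    intros p _. apply is_derive_Reals, derivable_pt_lim_const.
  - intros p _. exact (linear_cont (V := R_NormedModule) l p Hl).
  - intros v. exists (fun _ => l v). split; [apply elem_const|].
    intros p _. apply (is_derive_ext (fun s : R => l p + s * l v)).
    + intros s. rewrite (linear_plus (V := R_NormedModule) l Hl),
        (linear_scal (V := R_NormedModule) l Hl).
      reflexivity.
    + auto_derive; [trivial | ring].
  - intros p Hp. apply (continuous_plus f g); auto.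
  - intros v. destruct (Df v) as [f' [Ef Hf']], (Dg v) as [g' [Eg Hg']].
    exists (fun p => f' p + g' p). split; [now apply elem_plus|].
    intros p Hp. apply (is_derive_plus (V := R_NormedModule)); auto.
  - intros p Hp. apply (continuous_mult f g); auto.
  - intros v. destruct (Df v) as [f' [Ef Hf']], (Dg v) as [g' [Eg Hg']].
    exists (fun p => f' p * g p + f p * g' p).
    split; [now apply elem_plus; apply elem_mult|].
    intros p Hp.
    pose proof (is_derive_mult _ _ _ _ _ (Hf' p Hp) (Hg' p Hp) Rmult_comm) as H.
    cbv beta in H; rewrite scal_zero_plus in H. exact H.
  - intros p Hp. apply (continuous_comp f Rinv); [auto | apply continuous_Rinv; auto].
  - intros v. destruct (Df v) as [f' [Ef Hf']].
    exists (fun p => -1 * (f' p * (/ f p * / f p))). split.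
    { repeat apply elem_mult; auto using elem_const, elem_inv. }
    intros p Hp.
    assert (H0 : f (plus p (scal (0 : R) v)) <> 0) by (rewrite scal_zero_plus; auto).
    pose proof (is_derive_inv _ _ _ (Hf' p Hp) H0) as H.
    cbv beta in H; rewrite scal_zero_plus in H.
    replace (-1 * (f' p * (/ f p * / f p))) with (- f' p / f p ^ 2) by (field; auto).
    exact H.
  - intros p Hp. apply (continuous_comp f sqrt); [auto | apply continuous_sqrt].
  - intros v. destruct (Df v) as [f' [Ef Hf']].
    exists (fun p => f' p * / (2 * sqrt (f p))). split.
    { apply elem_mult; [assumption|]. apply elem_inv.
      - intros p Hp. pose proof (sqrt_lt_R0 _ (Hn p Hp)). lra.
      - apply elem_mult; [apply elem_const | now apply elem_sqrt]. }
    intros p Hp.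
    assert (H0 : 0 < f (plus p (scal (0 : R) v))) by (rewrite scal_zero_plus; auto).
    pose proof (is_derive_sqrt _ _ _ (Hf' p Hp) H0) as H.
    cbv beta in H; rewrite scal_zero_plus in H. exact H.
  - intros p Hp. apply (continuous_comp f cos); [auto | apply continuous_cos].
  - intros v. destruct (Df v) as [f' [Ef Hf']].
    exists (fun p => f' p * (-1 * sin (f p))). split.
    { repeat apply elem_mult; auto using elem_const, elem_sin. }
    intros p Hp.
    pose proof (is_derive_comp cos _ _ _ _ (is_derive_cos _) (Hf' p Hp)) as H.
    cbv beta in H; rewrite scal_zero_plus in H.
    replace (f' p * (-1 * sin (f p))) with (f' p * (- sin (f p))) by ring. exact H.
  - intros p Hp. apply (continuous_comp f sin); [auto | apply continuous_sin].
  - intros v. destruct (Df v) as [f' [Ef Hf']].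
    exists (fun p => f' p * cos (f p)). split.
    { apply elem_mult; auto using elem_cos. }
    intros p Hp.
    pose proof (is_derive_comp sin _ _ _ _ (is_derive_sin _) (Hf' p Hp)) as H.
    cbv beta in H; rewrite scal_zero_plus in H. exact H.
  - intros p Hp. apply (continuous_ext_loc g f).
    + generalize (HU p Hp). apply filter_imp. exact He.
    + auto.
  - intros v. destruct (Df v) as [f' [Ef Hf']]. exists f'. split; [assumption|].
    intros p Hp. apply (is_derive_ext_loc (fun s : R => f (plus p (scal s v)))); auto.
    generalize (line_in_open U p v HU Hp). apply filter_imp. intros s Hs. auto.
Qed.

Lemma elementary_smooth_on {V : NormedModule R_AbsRing} (U : V -> Prop) (f : V -> R) :
  open U -> elementary U f -> smooth_on U f.
Proof.
  intros HU Hf vs.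
  assert (Hd : elementary U (iterD vs f)).
  { induction vs as [|v vs IH]; [exact Hf|].
    destruct (elementary_derivative U _ HU IH) as [_ H].
    destruct (H v) as [g [Hg Hd]].
    apply (elem_ext _ g); [|assumption].
    intros p Hp. symmetry. exact (is_derive_unique _ _ _ (Hd p Hp)). }
  destruct (elementary_derivative U _ HU Hd) as [Hc H].
  intros p Hp. split; [auto|].
  intros v. destruct (H v) as [g [_ Hg]]. exists (g p). auto.
Qed.

Lemma elementary_smooth {V : NormedModule R_AbsRing} (f : V -> R) :
  elementary (fun _ => True) f -> smooth f.
Proof. apply elementary_smooth_on. apply open_true. Qed.

(** * The metric and its derivatives *)

(** Up to the factor [1 - eps ^ 2], the metric is this Riemannian norm minus
    [eps * dx]; [kz_x] and [kz_y] are the partial derivatives of the metric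
    off the zero section. *)
Definition kz_root (eps : R) (xi : R * R) : R :=
  sqrt (fst xi ^ 2 + (1 - eps ^ 2) * snd xi ^ 2).

Definition kz_x (eps : R) (xi : R * R) : R :=
  / (1 - eps ^ 2) * (fst xi / kz_root eps xi - eps).

Definition kz_y (eps : R) (xi : R * R) : R := snd xi / kz_root eps xi.

Lemma kz_coef_pos (eps : R) : 0 < eps < 1 -> 0 < 1 - eps ^ 2.
Proof. intros H. nra. Qed.

Lemma pair_neq_zero (a b : R) : (a, b) <> (0, 0) -> 0 < a ^ 2 + b ^ 2.
Proof.
  intros H. destruct (Req_dec a 0) as [Ha|Ha].
  - destruct (Req_dec b 0) as [Hb|Hb]; [subst; now elim H|]. nra.
  - nra.
Qed.

Lemma kz_radicand_pos (eps : R) (xi : R * R) :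
  0 < eps < 1 -> xi <> (0, 0) -> 0 < fst xi ^ 2 + (1 - eps ^ 2) * snd xi ^ 2.
Proof.
  destruct xi as [a b]. intros He Hxi. simpl fst. simpl snd.
  pose proof (pair_neq_zero a b Hxi). pose proof (kz_coef_pos eps He).
  destruct (Req_dec b 0) as [->|Hb]; [nra|].
  assert (0 < b ^ 2) by nra. pose proof (pow2_ge_0 a). nra.
Qed.

Lemma kz_root_pos (eps : R) (xi : R * R) :
  0 < eps < 1 -> xi <> (0, 0) -> 0 < kz_root eps xi.
Proof. intros. apply sqrt_lt_R0. now apply kz_radicand_pos. Qed.

Lemma kz_root_sqr (eps : R) (xi : R * R) :
  0 < eps < 1 ->
  kz_root eps xi * kz_root eps xi = fst xi ^ 2 + (1 - eps ^ 2) * snd xi ^ 2.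
Proof.
  intros He. apply sqrt_sqrt. pose proof (kz_coef_pos eps He).
  pose proof (pow2_ge_0 (fst xi)). pose proof (pow2_ge_0 (snd xi)). nra.
Qed.

(** [kz_root ^ 2 - (eps * fst xi) ^ 2] is [(1 - eps ^ 2) * |xi| ^ 2]. *)
Lemma kz_pos (eps : R) (p xi : R * R) :
  0 < eps < 1 -> xi <> (0, 0) -> 0 < katok_ziller eps p xi.
Proof.
  intros He Hxi.
  change (katok_ziller eps p xi)
    with (/ (1 - eps ^ 2) * (kz_root eps xi - eps * fst xi)).
  pose proof (kz_coef_pos eps He) as Hk. apply Rmult_lt_0_compat.
  - now apply Rinv_0_lt_compat.
  - pose proof (kz_root_pos eps xi He Hxi). pose proof (kz_root_sqr eps xi He) as Hr.
    assert (0 < (1 - eps ^ 2) * (fst xi ^ 2 + snd xi ^ 2)).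
    { apply Rmult_lt_0_compat; [assumption|].
      destruct xi as [a b]. now apply pair_neq_zero. }
    nra.
Qed.

Lemma kz_derive (eps : R) (p v w : R * R) :
  0 < eps < 1 -> v <> (0, 0) ->
  is_derive (fun s : R => katok_ziller eps p (plus v (scal s w))) 0
    (kz_x eps v * fst w + kz_y eps v * snd w).
Proof.
  intros He Hv.
  pose proof (kz_coef_pos eps He). pose proof (kz_radicand_pos eps v He Hv) as HQ.
  pose proof (kz_root_pos eps v He Hv) as Hr.
  destruct v as [a b], w as [c d]. unfold kz_x, kz_y, kz_root in *. simpl fst in *. simpl snd in *.
  apply (is_derive_ext (fun s => / (1 - eps ^ 2) *
    (sqrt ((a + s * c) ^ 2 + (1 - eps ^ 2) * (b + s * d) ^ 2) - eps * (a + s * c)))).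
  { reflexivity. }
  auto_derive; replace (a + 0 * c) with a by ring; replace (b + 0 * d) with b by ring.
  - nra.
  - replace (a * (a * 1) + (1 - eps * (eps * 1)) * (b * (b * 1)))
      with (a ^ 2 + (1 - eps ^ 2) * b ^ 2) by ring.
    field. split; lra.
Qed.

(** By homogeneity the Hessian of the norm annihilates [v], so it is a
    multiple of the square of the linear form [w |-> fst v * snd w - snd v * fst w];
    the multiple is the inverse cube of [kz_root]. *)
Lemma kz_x_derive (eps : R) (v w : R * R) :
  0 < eps < 1 -> v <> (0, 0) ->
  is_derive (fun s : R => kz_x eps (plus v (scal s w))) 0
    (- snd v * (fst v * snd w - snd v * fst w) / kz_root eps v ^ 3).
Proof.
  intros He Hv.
  pose proof (kz_coef_pos eps He). pose proof (kz_radicand_pos eps v He Hv) as HQ.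
  pose proof (kz_root_pos eps v He Hv) as Hr. pose proof (kz_root_sqr eps v He) as Hs.
  destruct v as [a b], w as [c d]. unfold kz_x, kz_y, kz_root in *. simpl fst in *. simpl snd in *.
  apply (is_derive_ext (fun s => / (1 - eps ^ 2) *
    ((a + s * c) / sqrt ((a + s * c) ^ 2 + (1 - eps ^ 2) * (b + s * d) ^ 2) - eps))).
  { reflexivity. }
  auto_derive; replace (a + 0 * c) with a by ring; replace (b + 0 * d) with b by ring;
  replace (a * (a * 1) + (1 - eps * (eps * 1)) * (b * (b * 1)))
    with (a ^ 2 + (1 - eps ^ 2) * b ^ 2) by ring.
  - repeat split; lra.
  - set (r := sqrt _) in *.
    field_simplify_eq; [|lra].
    replace (r ^ 3) with (r * (a ^ 2 + (1 - eps ^ 2) * b ^ 2)) by (rewrite <- Hs; ring).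
    replace (r ^ 2) with (a ^ 2 + (1 - eps ^ 2) * b ^ 2) by (rewrite <- Hs; ring).
    ring.
Qed.

Lemma kz_y_derive (eps : R) (v w : R * R) :
  0 < eps < 1 -> v <> (0, 0) ->
  is_derive (fun s : R => kz_y eps (plus v (scal s w))) 0
    (fst v * (fst v * snd w - snd v * fst w) / kz_root eps v ^ 3).
Proof.
  intros He Hv.
  pose proof (kz_coef_pos eps He). pose proof (kz_radicand_pos eps v He Hv) as HQ.
  pose proof (kz_root_pos eps v He Hv) as Hr. pose proof (kz_root_sqr eps v He) as Hs.
  destruct v as [a b], w as [c d]. unfold kz_x, kz_y, kz_root in *. simpl fst in *. simpl snd in *.
  apply (is_derive_ext (fun s => 
    ((b + s * d) / sqrt ((a + s * c) ^ 2 + (1 - eps ^ 2) * (b + s * d) ^ 2)))).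
  { reflexivity. }
  auto_derive; replace (a + 0 * c) with a by ring; replace (b + 0 * d) with b by ring;
  replace (a * (a * 1) + (1 - eps * (eps * 1)) * (b * (b * 1)))
    with (a ^ 2 + (1 - eps ^ 2) * b ^ 2) by ring.
  - repeat split; lra.
  - set (r := sqrt _) in *.
    field_simplify_eq; [|lra].
    replace (r ^ 2) with (a ^ 2 + (1 - eps ^ 2) * b ^ 2) by (rewrite <- Hs; ring).
    ring.
Qed.

Lemma plane_punctured_open : open (fun v : R * R => v <> (0, 0)).
Proof.
  apply (open_ext (fun v : R * R => 0 < fst v * fst v + snd v * snd v)).
  - intros [a b]. simpl. split.
    + intros H E. injection E as -> ->. lra.
    + intros H. pose proof (pair_neq_zero a b H). lra.
  - apply (open_comp (fun v : R * R => fst v * fst v + snd v * snd v) (fun r => 0 < r)).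
    + intros v _. apply (continuous_plus (fun v : R * R => fst v * fst v) (fun v => snd v * snd v)).
      * apply (continuous_mult (fun v : R * R => fst v) (fun v => fst v)); apply continuous_fst.
      * apply (continuous_mult (fun v : R * R => snd v) (fun v => snd v)); apply continuous_snd.
    + apply open_gt.
Qed.

Lemma plane_line_zero (v w : R * R) : plus v (scal (0 : R) w) = v.
Proof.
  exact (scal_zero_plus (V := prod_NormedModule R_AbsRing R_NormedModule R_NormedModule) v w).
Qed.

Definition kz_differential (eps : R) (v w : R * R) : R :=
  kz_x eps v * fst w + kz_y eps v * snd w.

Definition cross (v w : R * R) : R := fst v * snd w - snd v * fst w.

Lemma kz_D (eps : R) (p v w : R * R) :
  0 < eps < 1 -> v <> (0, 0) ->
  D w (katok_ziller eps p) v = kz_differential eps v w.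
Proof. intros. now apply is_derive_unique, kz_derive. Qed.

Lemma kz_energy_derive (eps : R) (p v w : R * R) :
  0 < eps < 1 -> v <> (0, 0) ->
  D w (fun v => katok_ziller eps p v ^ 2 / 2) v
  = katok_ziller eps p v * kz_differential eps v w.
Proof.
  intros He Hv. apply is_derive_unique.
  pose proof (kz_derive eps p v w He Hv) as H.
  rewrite Rmult_comm.
  apply (is_derive_comp (fun x : R => x ^ 2 / 2)
    (fun s : R => katok_ziller eps p (plus v (scal s w)))); [|exact H].
  cbv beta. rewrite plane_line_zero. auto_derive; [trivial | field].
Qed.

Lemma kz_fundamental_tensor (eps : R) (u w p v : R * R) :
  0 < eps < 1 -> v <> (0, 0) ->
  fundamental_tensor (katok_ziller eps) u w p v
  = kz_differential eps v u * kz_differential eps v w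
    + katok_ziller eps p v * (cross v u * cross v w) / kz_root eps v ^ 3.
Proof.
  intros He Hv. pose proof (kz_root_pos eps v He Hv) as Hr.
  apply is_derive_unique.
  apply (is_derive_ext_loc (fun s : R => katok_ziller eps p (plus v (scal s u))
    * (kz_x eps (plus v (scal s u)) * fst w + kz_y eps (plus v (scal s u)) * snd w))).
  { generalize (line_in_open _ v u plane_punctured_open Hv). apply filter_imp.
    intros s Hs. symmetry. now apply kz_energy_derive. }
  pose proof (is_derive_scal _ _ (fst w) _ (kz_x_derive eps v u He Hv)) as Hx.
  pose proof (is_derive_scal _ _ (snd w) _ (kz_y_derive eps v u He Hv)) as Hy.
  pose proof (is_derive_plus _ _ _ _ _ Hx Hy) as Hxy.
  pose proof (is_derive_mult _ _ _ _ _ (kz_derive eps p v u He Hv) Hxy Rmult_comm) as H.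
  cbv beta in H. rewrite plane_line_zero in H.
  match type of H with is_derive _ _ ?l => replace (_ + _) with l end.
  - revert H. apply is_derive_ext. intros s. simpl. unfold mult, plus; simpl. ring.
  - unfold kz_differential, cross, mult, plus; simpl. field. lra.
Qed.

Lemma cross_eq_zero (v w : R * R) :
  v <> (0, 0) -> cross v w = 0 -> exists m, w = (m * fst v, m * snd v).
Proof.
  destruct v as [a b], w as [c d]. unfold cross. simpl. intros Hv H.
  pose proof (pair_neq_zero a b Hv).
  exists ((a * c + b * d) / (a ^ 2 + b ^ 2)).
  assert (Ha : a * (a * d - b * c) = 0) by (rewrite H; ring).
  assert (Hb : b * (a * d - b * c) = 0) by (rewrite H; ring).
  f_equal; field_simplify_eq; lra.
Qed.

Lemma kz_euler (eps : R) (p v : R * R) :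
  0 < eps < 1 -> v <> (0, 0) -> kz_differential eps v v = katok_ziller eps p v.
Proof.
  intros He Hv. pose proof (kz_root_pos eps v He Hv) as Hr.
  pose proof (kz_root_sqr eps v He) as Hs. pose proof (kz_coef_pos eps He).
  change (katok_ziller eps p v)
    with (/ (1 - eps ^ 2) * (kz_root eps v - eps * fst v)).
  unfold kz_differential, kz_x, kz_y. field_simplify_eq; nra.
Qed.

(** Both terms of the fundamental tensor are squares with nonnegative weights;
    the second vanishes only on multiples of [v], where the first does not. *)
Lemma kz_strongly_convex (eps : R) :
  0 < eps < 1 -> strongly_convex (katok_ziller eps).
Proof.
  intros He p v Hv w1 w2 Hw.
  rewrite !kz_fundamental_tensor by assumption.
  pose proof (kz_root_pos eps v He Hv) as Hr.
  pose proof (kz_root_sqr eps v He) as Hs.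
  pose proof (kz_pos eps p v He Hv) as HF.
  set (F := katok_ziller eps p v) in *.
  set (g := kz_differential eps v (w1, w2)). set (c := cross v (w1, w2)).
  replace (_ + _) with (g * g + F * / kz_root eps v ^ 3 * (c * c)).
  2: { unfold g, c, kz_differential, cross, e1, e2; simpl. field. lra. }
  assert (Hi : 0 < F * / kz_root eps v ^ 3).
  { apply Rmult_lt_0_compat; [assumption|]. apply Rinv_0_lt_compat. now apply pow_lt. }
  destruct (Req_dec c 0) as [Hc|Hc].
  - destruct (cross_eq_zero v (w1, w2) Hv Hc) as [m Hm].
    assert (Hm0 : m <> 0).
    { intros ->. apply Hw. rewrite Hm. f_equal; ring. }
    assert (Hg : g = m * F).
    { unfold g. rewrite Hm. unfold F. rewrite <- (kz_euler eps p v He Hv).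
      unfold kz_differential. simpl. ring. }
    assert (H : g <> 0).
    { rewrite Hg. apply Rmult_integral_contrapositive. split; lra. }
    rewrite Hc. pose proof (Rsqr_pos_lt g H). unfold Rsqr in *. lra.
  - pose proof (Rmult_lt_0_compat _ _ Hi (Rsqr_pos_lt c Hc)).
    pose proof (Rle_0_sqr g). unfold Rsqr in *. lra.
Qed.

Lemma kz_elementary (eps : R) :
  0 < eps < 1 ->
  elementary (fun q : R * R * (R * R) => snd q <> (0, 0))
    (fun q => katok_ziller eps (fst q) (snd q)).
Proof.
  intros He.
  assert (E1 : elementary (fun q : R * R * (R * R) => snd q <> (0, 0)) (fun q => fst (snd q))).
  { apply elem_linear. apply (is_linear_comp snd fst); [apply is_linear_snd | apply is_linear_fst]. }
  assert (E2 : elementary (fun q : R * R * (R * R) => snd q <> (0, 0)) (fun q => snd (snd q))).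
  { apply elem_linear. apply (is_linear_comp snd snd); apply is_linear_snd. }
  apply (elem_ext _ (fun q : R * R * (R * R) => / (1 - eps ^ 2) *
    (sqrt (fst (snd q) * fst (snd q) + (1 - eps ^ 2) * (snd (snd q) * snd (snd q)))
     + - eps * fst (snd q)))).
  { intros [p [a b]] _. unfold katok_ziller. simpl fst. simpl snd.
    replace (a * a) with (a ^ 2) by ring. replace (b * b) with (b ^ 2) by ring. ring. }
  apply elem_mult; [apply elem_const|]. apply elem_plus.
  - apply elem_sqrt.
    + intros [p [a b]] Hq. pose proof (kz_radicand_pos eps (a, b) He Hq).
      simpl in *. lra.
    + auto using elem_plus, elem_mult, elem_const.
  - auto using elem_mult, elem_const.
Qed.

Lemma kz_continuous (eps : R) (q : R * R * (R * R)) :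
  continuous (fun q => katok_ziller eps (fst q) (snd q)) q.
Proof.
  assert (C1 : continuous (fun q : R * R * (R * R) => fst (snd q)) q).
  { apply (continuous_comp snd fst); [apply continuous_snd | apply continuous_fst]. }
  assert (C2 : continuous (fun q : R * R * (R * R) => snd (snd q)) q).
  { apply (continuous_comp snd snd); apply continuous_snd. }
  assert (C3 : continuous (fun q : R * R * (R * R) => fst (snd q) ^ 2) q).
  { apply (continuous_comp _ (fun x => x ^ 2) q C1).
    apply (ex_derive_continuous (V := R_NormedModule)). auto_derive. trivial. }
  assert (C4 : continuous (fun q : R * R * (R * R) => (1 - eps ^ 2) * snd (snd q) ^ 2) q).
  { apply (continuous_comp _ (fun x => (1 - eps ^ 2) * x ^ 2) q C2).
    apply (ex_derive_continuous (V := R_NormedModule)). auto_derive. trivial. }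
  assert (C5 : continuous (fun q : R * R * (R * R) => eps * fst (snd q)) q).
  { apply (continuous_scal_r eps _ q C1). }
  unfold katok_ziller. apply (continuous_scal_r (/ (1 - eps ^ 2))
    (fun q : R * R * (R * R) => sqrt (fst (snd q) ^ 2 + (1 - eps ^ 2) * snd (snd q) ^ 2)
      - eps * fst (snd q))).
  apply (continuous_minus (fun q : R * R * (R * R) =>
    sqrt (fst (snd q) ^ 2 + (1 - eps ^ 2) * snd (snd q) ^ 2))); [|exact C5].
  apply (continuous_comp (fun q : R * R * (R * R) =>
    fst (snd q) ^ 2 + (1 - eps ^ 2) * snd (snd q) ^ 2) sqrt); [|apply continuous_sqrt].
  exact (continuous_plus _ _ q C3 C4).
Qed.

Lemma kz_zero (eps : R) (p : R * R) : katok_ziller eps p (0, 0) = 0.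
Proof.
  unfold katok_ziller. simpl fst. simpl snd.
  replace (0 ^ 2 + (1 - eps ^ 2) * 0 ^ 2) with 0 by ring. rewrite sqrt_0. ring.
Qed.

Lemma plane_eq_zero_dec (v : R * R) : v = (0, 0) \/ v <> (0, 0).
Proof.
  destruct v as [a b]. destruct (Req_dec a 0) as [->|Ha].
  - destruct (Req_dec b 0) as [->|Hb]; [now left|].
    right. intros E. injection E. assumption.
  - right. intros E. injection E. intros. auto.
Qed.

Lemma kz_is_finsler (eps : R) : 0 < eps < 1 -> is_finsler (katok_ziller eps).
Proof.
  intros He. split.
  - intros v x y. split; reflexivity.
  - apply kz_continuous.
  - apply elementary_smooth_on; [|now apply kz_elementary].
    apply (open_comp (fun q : R * R * (R * R) => snd q) (fun v => v <> (0, 0)));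
      [|apply plane_punctured_open].
    intros q _. apply continuous_snd.
  - intros p c v1 v2 Hc. unfold katok_ziller. simpl fst. simpl snd.
    replace ((c * v1) ^ 2 + (1 - eps ^ 2) * (c * v2) ^ 2)
      with (c ^ 2 * (v1 ^ 2 + (1 - eps ^ 2) * v2 ^ 2)) by ring.
    rewrite sqrt_mult_alt, sqrt_pow2 by nra. ring.
  - intros p v. destruct (plane_eq_zero_dec v) as [->|Hv].
    + rewrite kz_zero. lra.
    + left. now apply kz_pos.
  - intros p v. split.
    + intros H. destruct (plane_eq_zero_dec v) as [E|Hv]; [assumption|].
      pose proof (kz_pos eps p v He Hv). lra.
    + intros ->. apply kz_zero.
  - now apply kz_strongly_convex.
Qed.

(** * Hilbert form, Reeb field and angle form *)

Definition dir (t : R) : R * R := (cos t, sin t).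

Lemma dir_neq_zero (t : R) : dir t <> (0, 0).
Proof.
  unfold dir. intros E. injection E as Hc Hs.
  pose proof (sin2_cos2 t) as H. rewrite Hc, Hs in H. unfold Rsqr in H. lra.
Qed.

Lemma cos_sqr_sin (t : R) : cos t * cos t = 1 - sin t * sin t.
Proof. pose proof (sin2_cos2 t). unfold Rsqr in *. lra. Qed.

Lemma dir_radicand_pos (eps t : R) :
  0 < eps < 1 -> 0 < cos t ^ 2 + (1 - eps ^ 2) * sin t ^ 2.
Proof. intros He. exact (kz_radicand_pos eps (dir t) He (dir_neq_zero t)). Qed.

Lemma dir_root_sqr (eps t : R) :
  0 < eps < 1 ->
  kz_root eps (dir t) * kz_root eps (dir t) = 1 - eps ^ 2 * (sin t * sin t).
Proof.
  intros He. rewrite (kz_root_sqr eps _ He). simpl fst. simpl snd.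
  replace (cos t ^ 2) with (cos t * cos t) by ring. rewrite cos_sqr_sin. ring.
Qed.

Lemma dir_root_derive (eps t : R) :
  0 < eps < 1 ->
  is_derive (fun t => kz_root eps (dir t)) t
    (- eps ^ 2 * sin t * cos t / kz_root eps (dir t)).
Proof.
  intros He. pose proof (dir_radicand_pos eps t He) as HQ.
  pose proof (kz_root_pos eps _ He (dir_neq_zero t)) as Hr.
  apply (is_derive_ext (fun t => sqrt (cos t ^ 2 + (1 - eps ^ 2) * sin t ^ 2))); [reflexivity|].
  unfold kz_root, dir in *. simpl fst in *. simpl snd in *.
  auto_derive; [simpl in HQ; lra|].
  replace (cos t * (cos t * 1) + (1 - eps * (eps * 1)) * (sin t * (sin t * 1)))
    with (cos t ^ 2 + (1 - eps ^ 2) * sin t ^ 2) by ring.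
  field. lra.
Qed.

Lemma dir_x_derive (eps t : R) :
  0 < eps < 1 ->
  is_derive (fun t => kz_x eps (dir t)) t (- sin t / kz_root eps (dir t) ^ 3).
Proof.
  intros He. pose proof (kz_coef_pos eps He).
  pose proof (kz_root_pos eps _ He (dir_neq_zero t)) as Hr.
  pose proof (dir_root_sqr eps t He) as Hs.
  pose proof (dir_root_derive eps t He) as Hd.
  pose proof (is_derive_div cos _ t _ _ (is_derive_cos t) Hd) as Hq.
  pose proof (is_derive_minus _ _ _ _ _ (Hq (Rgt_not_eq _ _ Hr)) (is_derive_const eps t)) as Hm.
  pose proof (is_derive_scal _ _ (/ (1 - eps ^ 2)) _ Hm) as H1.
  match type of H1 with is_derive _ _ ?l => replace (- sin t / _) with l end;
    [exact H1|].
  unfold minus, plus, opp, zero; simpl.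
  set (r := kz_root eps (dir t)) in *.
  field_simplify_eq; [|lra].
  replace (r ^ 2) with (1 - eps ^ 2 * (sin t * sin t)) by (rewrite <- Hs; ring).
  replace (cos t ^ 2) with (1 - sin t * sin t) by (rewrite <- cos_sqr_sin; ring).
  ring.
Qed.

Lemma dir_y_derive (eps t : R) :
  0 < eps < 1 ->
  is_derive (fun t => kz_y eps (dir t)) t (cos t / kz_root eps (dir t) ^ 3).
Proof.
  intros He.
  pose proof (kz_root_pos eps _ He (dir_neq_zero t)) as Hr.
  pose proof (dir_root_sqr eps t He) as Hs.
  pose proof (dir_root_derive eps t He) as Hd.
  pose proof (is_derive_div sin _ t _ _ (is_derive_sin t) Hd (Rgt_not_eq _ _ Hr)) as H1.
  match type of H1 with is_derive _ _ ?l => replace (cos t / _) with l end;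
    [exact H1|].
  set (r := kz_root eps (dir t)) in *.
  field_simplify_eq; [|lra].
  replace (r ^ 2) with (1 - eps ^ 2 * (sin t * sin t)) by (rewrite <- Hs; ring).
  ring.
Qed.

Lemma D_base_of_fiber_fun (v : R * R * R) (h : R -> R) (q : R * R * R) :
  snd v = 0 -> D v (fun q : R * R * R => h (snd q)) q = 0.
Proof.
  intros Hv. unfold D. rewrite (Derive_ext _ (fun _ => h (snd q))).
  - apply Derive_const.
  - intros s. change (h (snd q + s * snd v) = h (snd q)). f_equal. rewrite Hv. ring.
Qed.

Lemma D_fiber_of_fiber_fun (h : R -> R) (q : R * R * R) (l : R) :
  is_derive h (snd q) l -> D u_t (fun q : R * R * R => h (snd q)) q = l.
Proof.
  intros H. apply is_derive_unique.
  apply (is_derive_ext (fun s => h (snd q + s))).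
  { intros s. change (h (snd q + s) = h (snd q + s * 1)). f_equal. ring. }
  replace l with (scal 1 l) by (unfold scal; simpl; unfold mult; simpl; ring).
  apply (is_derive_comp h (fun s => snd q + s)).
  - rewrite Rplus_0_r. exact H.
  - auto_derive; [trivial | ring].
Qed.

(** The metric does not depend on the base point, so all the forms that occur
    have coefficients depending on the fiber coordinate alone. *)
Definition fiber_form (a b c : R -> R) : form1 :=
  Form1 (fun q => a (snd q)) (fun q => b (snd q)) (fun q => c (snd q)).

Definition kz_hilbert (eps : R) : form1 :=
  fiber_form (fun t => kz_x eps (dir t)) (fun t => kz_y eps (dir t)) (fun _ => 0).

Lemma kz_hilbert_d (eps : R) :
  0 < eps < 1 ->
  ext_d (kz_hilbert eps) =
  Form2 (fun _ => 0)
    (fun q => sin (snd q) / kz_root eps (dir (snd q)) ^ 3)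
    (fun q => - cos (snd q) / kz_root eps (dir (snd q)) ^ 3).
Proof.
  intros He. unfold ext_d. f_equal; apply functional_extensionality; intros q; simpl.
  - rewrite (D_base_of_fiber_fun u_x (fun t => kz_y eps (dir t))) by reflexivity.
    rewrite (D_base_of_fiber_fun u_y (fun t => kz_x eps (dir t))) by reflexivity. ring.
  - rewrite (D_base_of_fiber_fun u_x (fun _ => 0)) by reflexivity.
    rewrite (D_fiber_of_fiber_fun _ _ _ (dir_x_derive eps (snd q) He)). field.
    apply Rgt_not_eq, kz_root_pos, dir_neq_zero; assumption.
  - rewrite (D_base_of_fiber_fun u_y (fun _ => 0)) by reflexivity.
    rewrite (D_fiber_of_fiber_fun _ _ _ (dir_y_derive eps (snd q) He)). field.
    apply Rgt_not_eq, kz_root_pos, dir_neq_zero; assumption.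
Qed.

(** The metric on the unit vector [dir t]. *)
Definition kz_dir (eps t : R) : R := / (1 - eps ^ 2) * (kz_root eps (dir t) - eps * cos t).

Lemma kz_dir_pos (eps t : R) : 0 < eps < 1 -> 0 < kz_dir eps t.
Proof. intros He. exact (kz_pos eps (0, 0) (dir t) He (dir_neq_zero t)). Qed.

(** The coefficient of [A /\ dA] on [dt /\ dx /\ dy], up to sign. *)
Definition kz_density (eps t : R) : R := kz_dir eps t / kz_root eps (dir t) ^ 3.

Lemma kz_density_pos (eps t : R) : 0 < eps < 1 -> 0 < kz_density eps t.
Proof.
  intros He. apply Rdiv_lt_0_compat; [now apply kz_dir_pos|].
  apply pow_lt, kz_root_pos, dir_neq_zero. assumption.
Qed.

Lemma kz_hilbert_wedge (eps : R) (q : R * R * R) :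
  0 < eps < 1 ->
  wedge (kz_hilbert eps) (ext_d (kz_hilbert eps)) q = - kz_density eps (snd q).
Proof.
  intros He. rewrite (kz_hilbert_d eps He). unfold wedge; simpl.
  set (t := snd q). pose proof (kz_coef_pos eps He).
  pose proof (kz_root_pos eps _ He (dir_neq_zero t)) as Hr.
  pose proof (dir_root_sqr eps t He) as Hs.
  unfold kz_density, kz_dir, kz_x, kz_y. simpl fst. simpl snd.
  set (r := kz_root eps (dir t)) in *.
  field_simplify_eq; [|lra].
  replace (r ^ 2) with (1 - eps ^ 2 * (sin t * sin t)) by (rewrite <- Hs; ring).
  replace (cos t ^ 2) with (1 - sin t * sin t) by (rewrite <- cos_sqr_sin; ring).
  ring.
Qed.

Lemma elem_opp {V : NormedModule R_AbsRing} (U : V -> Prop) (f : V -> R) :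
  elementary U f -> elementary U (fun p => - f p).
Proof.
  intros H. apply (elem_ext U (fun p => -1 * f p)); [intros; ring|].
  apply elem_mult; [apply elem_const | assumption].
Qed.

Notation elementary_fiber h :=
  (elementary (fun _ : R * R * R => True) (fun q : R * R * R => h (snd q))).

Lemma elem_sin_dir : elementary_fiber (fun t => sin t).
Proof. apply elem_sin, elem_linear, is_linear_snd. Qed.

Lemma elem_cos_dir : elementary_fiber (fun t => cos t).
Proof. apply elem_cos, elem_linear, is_linear_snd. Qed.

Lemma elem_root_dir (eps : R) :
  0 < eps < 1 -> elementary_fiber (fun t => kz_root eps (dir t)).
Proof.
  intros He.
  apply (elem_ext _ (fun q : R * R * R => sqrt (cos (snd q) * cos (snd q)
    + (1 - eps ^ 2) * (sin (snd q) * sin (snd q))))).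
  { intros [p t] _. unfold kz_root, dir. simpl fst. simpl snd. f_equal. ring. }
  apply elem_sqrt.
  - intros [p t] _. pose proof (dir_radicand_pos eps t He). simpl in *. lra.
  - auto using elem_plus, elem_mult, elem_const, elem_sin_dir, elem_cos_dir.
Qed.

Lemma elem_root_dir_inv (eps : R) :
  0 < eps < 1 -> elementary_fiber (fun t => / kz_root eps (dir t)).
Proof.
  intros He. apply elem_inv; [|now apply elem_root_dir].
  intros q _. apply Rgt_not_eq, kz_root_pos, dir_neq_zero; assumption.
Qed.

Lemma elem_kz_dir (eps : R) : 0 < eps < 1 -> elementary_fiber (fun t => kz_dir eps t).
Proof.
  intros He. unfold kz_dir, Rminus.
  auto using elem_plus, elem_mult, elem_const, elem_opp, elem_cos_dir, elem_root_dir.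
Qed.

Lemma elementary_hm_smooth (h : R -> R) :
  (forall t, h (t + 2 * PI) = h t) -> elementary_fiber h ->
  hm_smooth (fun q => h (snd q)).
Proof.
  intros Hp He. split; [|split].
  - intros t x y. split; reflexivity.
  - intros p t. apply Hp.
  - now apply elementary_smooth.
Qed.

Lemma dir_period (t : R) : dir (t + 2 * PI) = dir t.
Proof.
  pose proof (cos_period t 1) as Hc. pose proof (sin_period t 1) as Hs.
  unfold dir. simpl in Hc, Hs. f_equal; [rewrite <- Hc | rewrite <- Hs]; f_equal; ring.
Qed.

Lemma hm_smooth_zero : hm_smooth (fun q : R * R * R => 0).
Proof. apply (elementary_hm_smooth (fun _ => 0)); [reflexivity | apply elem_const]. Qed.

(** The differential of the metric is homogeneous of degree zero, which is why
    it descends to rays. *)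
Lemma kz_homogeneous_derivative (eps rho t : R) :
  0 < eps < 1 -> 0 < rho ->
  (rho * cos t, rho * sin t) <> (0, 0) /\
  kz_x eps (rho * cos t, rho * sin t) = kz_x eps (dir t) /\
  kz_y eps (rho * cos t, rho * sin t) = kz_y eps (dir t).
Proof.
  intros He Hrho. pose proof (kz_root_pos eps _ He (dir_neq_zero t)) as Hr.
  pose proof (kz_coef_pos eps He).
  assert (E : kz_root eps (rho * cos t, rho * sin t) = rho * kz_root eps (dir t)).
  { unfold kz_root, dir. simpl fst. simpl snd.
    replace ((rho * cos t) ^ 2 + (1 - eps ^ 2) * (rho * sin t) ^ 2)
      with (rho ^ 2 * (cos t ^ 2 + (1 - eps ^ 2) * sin t ^ 2)) by ring.
    rewrite sqrt_mult_alt, sqrt_pow2 by nra. ring. }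
  split; [|unfold kz_x, kz_y; rewrite E; simpl; split; field; lra].
  intros H0. injection H0 as H1 H2. apply (dir_neq_zero t). unfold dir. f_equal; nra.
Qed.

Lemma kz_hilbert_is_hilbert (eps : R) :
  0 < eps < 1 -> is_hilbert_form (katok_ziller eps) (kz_hilbert eps).
Proof.
  intros He. split; [split; [|split]|split].
  - apply (elementary_hm_smooth (fun t => kz_x eps (dir t))).
    + intros t. now rewrite dir_period.
    + unfold kz_x, Rminus, Rdiv.
      auto 8 using elem_plus, elem_mult, elem_const, elem_cos_dir, elem_root_dir_inv.
  - apply (elementary_hm_smooth (fun t => kz_y eps (dir t))).
    + intros t. now rewrite dir_period.
    + unfold kz_y, Rdiv. auto using elem_mult, elem_sin_dir, elem_root_dir_inv.
  - apply hm_smooth_zero.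
  - intros q. rewrite (kz_hilbert_wedge eps q He).
    pose proof (kz_density_pos eps (snd q) He). lra.
  - intros p rho t Hrho.
    destruct (kz_homogeneous_derivative eps rho t He Hrho) as [Hn [Hx Hy]].
    rewrite !kz_D by assumption. unfold kz_differential. rewrite Hx, Hy. simpl.
    repeat split; ring.
Qed.

(** The coefficients are prescribed at every unit vector, so the form selected
    by [epsilon] can be computed. *)
Lemma hilbert_form_unique (F : metric) (A B : form1) :
  is_hilbert_form F A -> is_hilbert_form F B -> A = B.
Proof.
  destruct A as [ax ay at'], B as [bx by' bt]. intros [_ [_ HA]] [_ [_ HB]].
  simpl in HA, HB.
  f_equal; apply functional_extensionality; intros [p t];
    destruct (HA p 1 t Rlt_0_1) as [H1 [H2 H3]], (HB p 1 t Rlt_0_1) as [H4 [H5 H6]];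
    congruence.
Qed.

Lemma hilbert_form_kz (eps : R) :
  0 < eps < 1 -> hilbert_form (katok_ziller eps) = kz_hilbert eps.
Proof.
  intros He. pose proof (kz_hilbert_is_hilbert eps He) as H.
  apply (hilbert_form_unique (katok_ziller eps)); [|assumption].
  unfold hilbert_form. apply epsilon_spec. now exists (kz_hilbert eps).
Qed.

(** The Reeb field of a metric with translation invariance is the geodesic field
    of straight lines: the horizontal lift of the unit vector in the given
    direction. *)
Definition kz_reeb (eps : R) : vfield :=
  VField (fun q => cos (snd q) / kz_dir eps (snd q))
         (fun q => sin (snd q) / kz_dir eps (snd q)) (fun _ => 0).

Lemma kz_dir_period (eps t : R) : kz_dir eps (t + 2 * PI) = kz_dir eps t.
Proof.
  unfold kz_dir. change (cos (t + 2 * PI)) with (fst (dir (t + 2 * PI))).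
  now rewrite dir_period.
Qed.

Lemma kz_dir_euler (eps t : R) :
  0 < eps < 1 ->
  kz_x eps (dir t) * cos t + kz_y eps (dir t) * sin t = kz_dir eps t.
Proof. intros He. exact (kz_euler eps (0, 0) (dir t) He (dir_neq_zero t)). Qed.

Lemma kz_reeb_is_reeb (eps : R) :
  0 < eps < 1 -> is_reeb_field (kz_hilbert eps) (kz_reeb eps).
Proof.
  intros He.
  assert (Ei : elementary_fiber (fun t => / kz_dir eps t)).
  { apply elem_inv; [|now apply elem_kz_dir].
    intros q _. apply Rgt_not_eq, kz_dir_pos, He. }
  split; [split; [|split]|].
  - apply (elementary_hm_smooth (fun t => cos t / kz_dir eps t)).
    + intros t. rewrite kz_dir_period.
      change (cos (t + 2 * PI)) with (fst (dir (t + 2 * PI))). now rewrite dir_period.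
    + apply elem_mult; [apply elem_cos_dir | exact Ei].
  - apply (elementary_hm_smooth (fun t => sin t / kz_dir eps t)).
    + intros t. rewrite kz_dir_period.
      change (sin (t + 2 * PI)) with (snd (dir (t + 2 * PI))). now rewrite dir_period.
    + apply elem_mult; [apply elem_sin_dir | exact Ei].
  - apply hm_smooth_zero.
  - intros q. rewrite (kz_hilbert_d eps He). unfold pairing; simpl.
    pose proof (kz_dir_pos eps (snd q) He).
    pose proof (kz_root_pos eps _ He (dir_neq_zero (snd q))).
    split; [|split; [|split]]; try (field; lra).
    rewrite Rmult_0_l, Rplus_0_r.
    rewrite <- (kz_dir_euler eps (snd q) He) in *. field. lra.
Qed.

(** The horizontal components of [i_X dA = 0] force the vertical component of
    [X] to vanish, because [dA] pairs [d/dt] with the nonzero covector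
    [(- sin t, cos t)] up to a factor; the vertical component makes [X] parallel
    to [dir t], and [A(X) = 1] fixes its length. *)
Lemma reeb_field_kz (eps : R) :
  0 < eps < 1 -> reeb_field (katok_ziller eps) = kz_reeb eps.
Proof.
  intros He. pose proof (kz_reeb_is_reeb eps He) as HK.
  assert (H : is_reeb_field (kz_hilbert eps) (reeb_field (katok_ziller eps))).
  { unfold reeb_field. rewrite (hilbert_form_kz eps He).
    apply epsilon_spec. now exists (kz_reeb eps). }
  destruct H as [_ H], (reeb_field (katok_ziller eps)) as [x y z].
  assert (E : forall q, x q = cos (snd q) / kz_dir eps (snd q) /\
    y q = sin (snd q) / kz_dir eps (snd q) /\ z q = 0).
  { intros q. specialize (H q). rewrite (kz_hilbert_d eps He) in H.
    unfold pairing in H.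
    cbn [pairing interior kz_hilbert fiber_form a_x a_y a_t w_xy w_xt w_yt X_x X_y X_t] in H.
    destruct H as [H1 [H2 [H3 H4]]].
    set (t := snd q) in *. pose proof (kz_dir_pos eps t He) as HF.
    pose proof (kz_root_pos eps _ He (dir_neq_zero t)) as Hr.
    pose proof (kz_dir_euler eps t He) as HE. pose proof (cos_sqr_sin t) as Hcs.
    set (a := kz_x eps (dir t)) in *. set (b := kz_y eps (dir t)) in *.
    set (F := kz_dir eps t) in *. set (r3 := kz_root eps (dir t) ^ 3) in *.
    assert (Hr3 : 0 < r3) by now apply pow_lt.
    assert (G2 : z q * sin t = 0).
    { apply (Rmult_eq_reg_r (/ r3)); [|apply Rinv_neq_0_compat; lra].
      unfold Rdiv in *. lra. }
    assert (G3 : z q * cos t = 0).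
    { apply (Rmult_eq_reg_r (/ r3)); [|apply Rinv_neq_0_compat; lra].
      unfold Rdiv in *. lra. }
    assert (G4 : x q * sin t = y q * cos t).
    { apply (Rmult_eq_reg_r (/ r3)); [|apply Rinv_neq_0_compat; lra].
      unfold Rdiv in *. lra. }
    assert (Hz : z q = 0).
    { replace (z q) with (z q * cos t * cos t + z q * sin t * sin t).
      - rewrite G2, G3. ring.
      - rewrite !Rmult_assoc, Hcs. ring. }
    assert (H1' : a * x q + b * y q = 1) by lra.
    split; [|split; [|assumption]].
    - apply (Rmult_eq_reg_r F); [|lra]. field_simplify; [|lra].
      rewrite <- HE.
      transitivity (cos t * (a * x q + b * y q) + b * (x q * sin t - y q * cos t)); [ring|].
      rewrite H1', G4. ring.
    - apply (Rmult_eq_reg_r F); [|lra]. field_simplify; [|lra].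
      rewrite <- HE.
      transitivity (sin t * (a * x q + b * y q) - a * (x q * sin t - y q * cos t)); [ring|].
      rewrite H1', G4. ring. }
  unfold kz_reeb. f_equal; apply functional_extensionality; intros q; apply (E q).
Qed.

(** * Fiber integrals *)

Lemma is_RInt_half_turn_odd (h : R -> R) :
  (forall t, continuous h t) -> (forall t, h (t + PI) = - h t) ->
  is_RInt h 0 (2 * PI) 0.
Proof.
  intros Hc Ho.
  assert (Hi : forall a b, is_RInt h a b (RInt h a b)).
  { intros a b. apply (RInt_correct (V := R_CompleteNormedModule)), ex_RInt_continuous. auto. }
  assert (H2 : is_RInt h PI (2 * PI) (- RInt h 0 PI)).
  { assert (E : RInt h PI (2 * PI) = - RInt h 0 PI).
    { pose proof (Hi (1 * 0 + PI) (1 * PI + PI)) as H.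
      apply is_RInt_comp_lin in H.
      apply (is_RInt_ext _ (fun t => opp (h t))) in H.
      2: { intros t _. rewrite !Rmult_1_l. rewrite Ho.
           unfold scal, opp; simpl; unfold mult; simpl. ring. }
      apply (is_RInt_unique (V := R_CompleteNormedModule)) in H.
      replace (1 * 0 + PI) with PI in H by ring.
      replace (1 * PI + PI) with (2 * PI) in H by ring.
      exact (eq_trans (eq_sym H) (is_RInt_unique (V := R_CompleteNormedModule) _ _ _ _
        (is_RInt_opp _ _ _ _ (Hi 0 PI)))). }
    rewrite <- E. apply Hi. }
  pose proof (is_RInt_Chasles _ _ _ _ _ _ (Hi 0 PI) H2) as H.
  unfold plus in H; simpl in H. rewrite Rplus_opp_r in H. exact H.
Qed.

Lemma cos_sin_denominator_pos (m t : R) : 0 < m -> 0 < cos t * cos t + m * (sin t * sin t).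
Proof.
  intros Hm. rewrite cos_sqr_sin.
  assert (0 <= sin t * sin t <= 1).
  { pose proof (cos_sqr_sin t). pose proof (Rle_0_sqr (cos t)). pose proof (Rle_0_sqr (sin t)).
    unfold Rsqr in *. lra. }
  destruct (Rle_or_lt m 1); nra.
Qed.

(** This is the continuous branch of [atan (m * tan t)]: the two angles differ
    by the angle whose tangent is given by the subtraction formula, and that
    difference stays in [(-PI/2, PI/2)]. *)
Definition turning_angle (m t : R) : R :=
  t + atan ((m - 1) * (sin t * cos t) / (cos t * cos t + m * (sin t * sin t))).

Lemma turning_angle_derive (m t : R) :
  0 < m ->
  is_derive (turning_angle m) t (m / (cos t * cos t + m ^ 2 * (sin t * sin t))).
Proof.
  intros Hm. pose proof (cos_sin_denominator_pos m t Hm) as Hd.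
  assert (Hd2 : 0 < cos t * cos t + m ^ 2 * (sin t * sin t)).
  { apply cos_sin_denominator_pos. nra. }
  unfold turning_angle. auto_derive; [lra|].
  rewrite cos_sqr_sin in *.
  set (s := sin t) in *. set (c := cos t) in *.
  assert (Hc : c ^ 2 = 1 - s * s) by (unfold c, s; rewrite <- cos_sqr_sin; ring).
  assert (Hq : 0 < (1 - s * s + m * (s * s)) ^ 2 + ((m - 1) * (s * c)) ^ 2).
  { pose proof (pow2_ge_0 ((m - 1) * (s * c))). pose proof (pow_lt _ 2 Hd). lra. }
  unfold Rsqr. field_simplify_eq.
  - replace (c ^ 4) with ((1 - s * s) * (1 - s * s)) by (rewrite <- Hc; ring).
    rewrite Hc. ring.
  - repeat split; try lra.
Qed.

Lemma turning_angle_2PI (m : R) : turning_angle m (2 * PI) - turning_angle m 0 = 2 * PI.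
Proof.
  unfold turning_angle. rewrite sin_2PI, sin_0, cos_2PI, cos_0.
  replace ((m - 1) * (0 * 1) / (1 * 1 + m * (0 * 0))) with 0 by (unfold Rdiv; ring).
  ring.
Qed.

Lemma sqrt_coef (eps : R) :
  0 < eps < 1 ->
  0 < sqrt (1 - eps ^ 2) < 1 /\ sqrt (1 - eps ^ 2) ^ 2 = 1 - eps ^ 2.
Proof.
  intros He. pose proof (kz_coef_pos eps He) as Hk.
  assert (E : sqrt (1 - eps ^ 2) ^ 2 = 1 - eps ^ 2) by (apply pow2_sqrt; lra).
  split; [split|assumption].
  - now apply sqrt_lt_R0.
  - rewrite <- sqrt_1 at 2. apply sqrt_lt_1; nra.
Qed.

Lemma dir_turning_angle_derive (eps t : R) :
  0 < eps < 1 ->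
  is_derive (turning_angle (sqrt (1 - eps ^ 2))) t
    (sqrt (1 - eps ^ 2) / kz_root eps (dir t) ^ 2).
Proof.
  intros He. destruct (sqrt_coef eps He) as [Hm Em].
  pose proof (turning_angle_derive _ t (proj1 Hm)) as H. rewrite Em in H.
  replace (kz_root eps (dir t) ^ 2)
    with (cos t * cos t + (1 - eps ^ 2) * (sin t * sin t)); [exact H|].
  pose proof (dir_root_sqr eps t He) as E. rewrite cos_sqr_sin.
  replace (kz_root eps (dir t) ^ 2) with (kz_root eps (dir t) * kz_root eps (dir t)) by ring.
  rewrite E. ring.
Qed.

Lemma dir_root_continuous (eps t : R) :
  0 < eps < 1 -> continuous (fun t => kz_root eps (dir t)) t.
Proof.
  intros He. apply (ex_derive_continuous (V := R_NormedModule)).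
  eexists. now apply dir_root_derive.
Qed.

Lemma quotient_by_root_continuous (eps : R) (n : nat) (h : R -> R) (t : R) :
  0 < eps < 1 -> continuous h t ->
  continuous (fun t => h t / kz_root eps (dir t) ^ n) t.
Proof.
  intros He Hh. apply (continuous_mult h (fun t => / kz_root eps (dir t) ^ n)); [assumption|].
  apply (continuous_comp (fun t => kz_root eps (dir t)) (fun x => / x ^ n)).
  - now apply dir_root_continuous.
  - apply (ex_derive_continuous (V := R_NormedModule)). auto_derive.
    apply pow_nonzero, Rgt_not_eq, kz_root_pos, dir_neq_zero; assumption.
Qed.

(** Explicitly, [(1 - eps ^ 2) * kz_density] is [1 / r ^ 2 - eps * cos t / r ^ 3]
    with [r] the root function, and the second summand is the derivative of the
    periodic function [eps * kz_y]. *)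
Lemma is_RInt_kz_density (eps : R) :
  0 < eps < 1 ->
  is_RInt (kz_density eps) 0 (2 * PI) (2 * PI / sqrt (1 - eps ^ 2) ^ 3).
Proof.
  intros He. destruct (sqrt_coef eps He) as [Hm Em]. pose proof (kz_coef_pos eps He) as Hk.
  set (m := sqrt (1 - eps ^ 2)) in *.
  set (G := fun t => / (1 - eps ^ 2) * (/ m * turning_angle m t - eps * kz_y eps (dir t))).
  replace (2 * PI / m ^ 3) with (minus (G (2 * PI)) (G 0)).
  2: { unfold G, minus, plus, opp; simpl.
    replace (dir (2 * PI)) with (dir 0) by (unfold dir; now rewrite cos_2PI, sin_2PI, cos_0, sin_0).
    transitivity (/ (1 - eps ^ 2) * (/ m * (turning_angle m (2 * PI) - turning_angle m 0)));
      [simpl; ring|].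
    rewrite turning_angle_2PI, <- Em. field. lra. }
  apply (is_RInt_derive (V := R_CompleteNormedModule)).
  - intros t _. pose proof (kz_root_pos eps _ He (dir_neq_zero t)) as Hr.
    pose proof (is_derive_scal _ _ (/ m) _ (dir_turning_angle_derive eps t He)) as H1.
    pose proof (is_derive_scal _ _ eps _ (dir_y_derive eps t He)) as H2.
    pose proof (is_derive_scal _ _ (/ (1 - eps ^ 2)) _ (is_derive_minus _ _ _ _ _ H1 H2)) as H.
    fold m in H. unfold kz_density, kz_dir.
    match type of H with is_derive _ _ ?l => replace (_ / _) with l end; [exact H|].
    unfold minus, plus, opp; simpl. field. split; [|split]; lra.
  - intros t _. unfold kz_density. apply quotient_by_root_continuous; [assumption|].
    unfold kz_dir. apply (continuous_scal_r (/ (1 - eps ^ 2))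
      (fun t => kz_root eps (dir t) - eps * cos t)).
    apply (continuous_minus (fun t => kz_root eps (dir t)) (fun t => eps * cos t)).
    + now apply dir_root_continuous.
    + apply (continuous_scal_r eps cos), continuous_cos.
Qed.

Lemma fiber_integral_kz (eps : R) (beta : form1) (p : R * R) :
  0 < eps < 1 ->
  fiber_integral (kz_hilbert eps) beta p = RInt (fun t => - a_t beta (p, t)) 0 (2 * PI).
Proof.
  intros He. unfold fiber_integral. apply RInt_ext. intros t _.
  rewrite (kz_hilbert_wedge eps _ He). simpl snd.
  pose proof (kz_density_pos eps t He). rewrite sign_eq_m1 by lra.
  change (-1 * a_t beta (p, t) = - a_t beta (p, t)). ring.
Qed.

Definition kz_angle (eps : R) : form1 :=
  fiber_form (fun _ => 0) (fun _ => 0) (fun t => - (kz_density eps t * sqrt (1 - eps ^ 2) ^ 3)).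

Lemma torus_smooth_const (c : R) : torus_smooth (fun _ => c).
Proof. split; [split; reflexivity|]. apply elementary_smooth, elem_const. Qed.

Lemma kz_angle_is_angle (eps : R) :
  0 < eps < 1 ->
  is_angle_volume (kz_hilbert eps) (kz_angle eps, fun _ => / sqrt (1 - eps ^ 2) ^ 3).
Proof.
  intros He. destruct (sqrt_coef eps He) as [Hm Em].
  assert (Hm3 : 0 < sqrt (1 - eps ^ 2) ^ 3) by now apply pow_lt.
  split; [|split; [|split; [|split; [|split]]]].
  - split; [|split]; try apply hm_smooth_zero.
    apply (elementary_hm_smooth (fun t => - (kz_density eps t * sqrt (1 - eps ^ 2) ^ 3))).
    + intros t. unfold kz_density. now rewrite kz_dir_period, dir_period.
    + apply elem_opp, elem_mult; [|apply elem_const]. apply elem_mult; [now apply elem_kz_dir|].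
      apply elem_inv.
      * intros q _. apply pow_nonzero, Rgt_not_eq, kz_root_pos, dir_neq_zero; assumption.
      * simpl. auto using elem_mult, elem_root_dir, elem_const.
  - apply torus_smooth_const.
  - intros _. apply Rinv_neq_0_compat. lra.
  - intros q. cbn [a_t kz_angle fiber_form]. pose proof (kz_density_pos eps (snd q) He).
    apply Ropp_neq_0_compat, Rmult_integral_contrapositive. split; lra.
  - intros q. rewrite (kz_hilbert_wedge eps q He). unfold wedge. 
    cbn [a_x a_y a_t kz_angle fiber_form w_xy w_xt w_yt pull_area]. field. lra.
  - intros p. rewrite (fiber_integral_kz eps _ p He). cbn [a_t kz_angle fiber_form snd].
    pose proof (is_RInt_scal _ _ _ (sqrt (1 - eps ^ 2) ^ 3) _ (is_RInt_kz_density eps He)) as H.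
    apply (is_RInt_unique (V := R_CompleteNormedModule)).
    replace vol_S1 with (scal (sqrt (1 - eps ^ 2) ^ 3) (2 * PI / sqrt (1 - eps ^ 2) ^ 3)).
    2: { change (sqrt (1 - eps ^ 2) ^ 3 * (2 * PI / sqrt (1 - eps ^ 2) ^ 3) = 2 * PI).
         field. lra. }
    revert H. apply is_RInt_ext. intros t _. unfold scal; simpl; unfold mult; simpl. ring.
Qed.

(** The wedge condition determines the angle form up to the density of the
    volume form at [p], and the normalisation of the fiber integral then
    determines that density. *)
Lemma angle_form_kz (eps : R) (p : R * R) (t : R) :
  0 < eps < 1 ->
  a_t (angle_form (katok_ziller eps)) (p, t)
  = - (kz_density eps t * sqrt (1 - eps ^ 2) ^ 3).
Proof.
  intros He. destruct (sqrt_coef eps He) as [Hm Em].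
  assert (Hm3 : 0 < sqrt (1 - eps ^ 2) ^ 3) by now apply pow_lt.
  assert (H : is_angle_volume (kz_hilbert eps) (angle_volume (katok_ziller eps))).
  { unfold angle_volume. rewrite (hilbert_form_kz eps He).
    apply epsilon_spec. eexists. apply (kz_angle_is_angle eps He). }
  unfold angle_form. destruct (angle_volume (katok_ziller eps)) as [alpha omega]. simpl fst.
  destruct H as [_ [_ [Ho [_ [Hw Hi]]]]].
  assert (Ha : forall t, a_t alpha (p, t) = - (/ omega p * kz_density eps t)).
  { intros s. specialize (Hw (p, s)). rewrite (kz_hilbert_wedge eps _ He) in Hw.
    unfold wedge in Hw. cbn [w_xy w_xt w_yt pull_area fst snd] in Hw.
    apply (Rmult_eq_reg_r (omega p)); [|apply Ho].
    field_simplify; [lra | apply Ho]. }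
  assert (E : / omega p * (2 * PI / sqrt (1 - eps ^ 2) ^ 3) = 2 * PI).
  { specialize (Hi p). rewrite (fiber_integral_kz eps _ p He) in Hi.
    pose proof (is_RInt_scal _ _ _ (/ omega p) _ (is_RInt_kz_density eps He)) as H.
    apply (is_RInt_ext _ (fun t => - a_t alpha (p, t))) in H.
    - apply (is_RInt_unique (V := R_CompleteNormedModule)) in H.
      exact (eq_trans (eq_sym H) Hi).
    - intros s _. rewrite Ha. unfold scal; simpl; unfold mult; simpl. ring. }
  rewrite Ha. pose proof PI_RGT_0.
  replace (sqrt (1 - eps ^ 2) ^ 3) with (/ omega p); [ring|].
  apply (Rmult_eq_reg_r (2 * PI / sqrt (1 - eps ^ 2) ^ 3)).
  - rewrite E. field. lra.
  - apply Rgt_not_eq, Rdiv_lt_0_compat; lra.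
Qed.

Lemma lie_kz_pull (eps : R) (f : R * R -> R) (q : R * R * R) :
  lie (kz_reeb eps) (pull_fun f) q
  = cos (snd q) / kz_dir eps (snd q) * D e1 f (fst q)
    + sin (snd q) / kz_dir eps (snd q) * D e2 f (fst q).
Proof.
  unfold lie. cbn [X_x X_y X_t kz_reeb].
  change (D u_x (pull_fun f) q) with (D e1 f (fst q)).
  change (D u_y (pull_fun f) q) with (D e2 f (fst q)). ring.
Qed.

(** A horizontal derivative leaves the fiber coordinate [t], hence the
    coefficients [a] and [b], fixed. *)
Lemma D_base_combination (a b : R -> R) (f g : R * R -> R) (v : R * R) (p : R * R) (t : R) :
  ex_derive (fun s : R => f (plus p (scal s v))) 0 ->
  ex_derive (fun s : R => g (plus p (scal s v))) 0 ->
  D (v, 0) (fun q : R * R * R => a (snd q) * f (fst q) + b (snd q) * g (fst q)) (p, t)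
  = a t * D v f p + b t * D v g p.
Proof.
  intros Hf Hg. apply is_derive_unique.
  apply (is_derive_ext (fun s : R => a t * f (plus p (scal s v)) + b t * g (plus p (scal s v)))).
  { intros s.
    change (a t * f (plus p (scal s v)) + b t * g (plus p (scal s v))
      = a (t + s * 0) * f (plus p (scal s v)) + b (t + s * 0) * g (plus p (scal s v))).
    now rewrite Rmult_0_r, Rplus_0_r. }
  apply (is_derive_plus (V := R_NormedModule)); apply is_derive_scal; now apply Derive_correct.
Qed.

Lemma lie2_kz_pull (eps : R) (f : R * R -> R) (p : R * R) (t : R) :
  smooth f ->
  lie (kz_reeb eps) (lie (kz_reeb eps) (pull_fun f)) (p, t)
  = (cos t * cos t * D e1 (D e1 f) p
     + sin t * cos t * (D e1 (D e2 f) p + D e2 (D e1 f) p)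
     + sin t * sin t * D e2 (D e2 f) p) / kz_dir eps t ^ 2.
Proof.
  intros Hf.
  replace (lie (kz_reeb eps) (pull_fun f)) with (fun q : R * R * R =>
    cos (snd q) / kz_dir eps (snd q) * D e1 f (fst q)
    + sin (snd q) / kz_dir eps (snd q) * D e2 f (fst q)).
  2: { apply functional_extensionality. intros q. symmetry. apply lie_kz_pull. }
  pose proof (fun v => proj2 (Hf (e1 :: nil)%list p I) v) as H1.
  pose proof (fun v => proj2 (Hf (e2 :: nil)%list p I) v) as H2.
  set (a := fun t => cos t / kz_dir eps t). set (b := fun t => sin t / kz_dir eps t).
  set (g := fun q : R * R * R => cos (snd q) / kz_dir eps (snd q) * D e1 f (fst q)
    + sin (snd q) / kz_dir eps (snd q) * D e2 f (fst q)).
  assert (Hx : D u_x g (p, t) = a t * D e1 (D e1 f) p + b t * D e1 (D e2 f) p)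
    by exact (D_base_combination a b (D e1 f) (D e2 f) e1 p t (H1 e1) (H2 e1)).
  assert (Hy : D u_y g (p, t) = a t * D e2 (D e1 f) p + b t * D e2 (D e2 f) p)
    by exact (D_base_combination a b (D e1 f) (D e2 f) e2 p t (H1 e2) (H2 e2)).
  unfold lie. rewrite Hx, Hy. unfold a, b. cbn [X_x X_y X_t kz_reeb snd fst].
  unfold Rdiv. rewrite <- pow_inv. ring.
Qed.

(** Since [1 / F = r + eps * cos t] with [r] the root function, the integrand is
    [Q / r ^ 2 + eps * cos t * Q / r ^ 3] for the quadratic form [Q].  The second
    term changes sign under a half turn and integrates to zero.  The first has
    a primitive made of [t], [turning_angle] and [ln r], of which [ln r] is
    periodic: this is how the mixed second derivatives disappear from the
    operator. *)
Lemma is_RInt_kz_quadratic (eps A B C : R) :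
  0 < eps < 1 ->
  is_RInt (fun t => kz_density eps t * ((cos t * cos t * A + sin t * cos t * B
      + sin t * sin t * C) / kz_dir eps t ^ 2)) 0 (2 * PI)
    (2 * PI / (1 + sqrt (1 - eps ^ 2)) * (A + C / sqrt (1 - eps ^ 2))).
Proof.
  intros He. destruct (sqrt_coef eps He) as [Hm Em]. pose proof (kz_coef_pos eps He) as Hk.
  set (m := sqrt (1 - eps ^ 2)) in *.
  set (Q := fun t => cos t * cos t * A + sin t * cos t * B + sin t * sin t * C).
  assert (HQ : forall t, continuous Q t).
  { intros t. apply (ex_derive_continuous (V := R_NormedModule)). unfold Q. auto_derive. trivial. }
  assert (Heven : is_RInt (fun t => Q t / kz_root eps (dir t) ^ 2) 0 (2 * PI)
    (2 * PI / (1 + m) * (A + C / m))).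
  { (* From r ^ 2 = 1 - eps ^ 2 * sin ^ 2 one gets
       sin ^ 2 / r ^ 2 = (1 / r ^ 2 - 1) / eps ^ 2 and
       sin * cos / r ^ 2 = - (ln r)' / eps ^ 2. *)
    set (G := fun t => (A - (A - C) / eps ^ 2) * (/ m * turning_angle m t)
      + (A - C) / eps ^ 2 * t - B / eps ^ 2 * ln (kz_root eps (dir t))).
    replace (2 * PI / (1 + m) * (A + C / m)) with (minus (G (2 * PI)) (G 0)).
    2: { unfold G, minus, plus, opp; simpl.
      replace (dir (2 * PI)) with (dir 0)
        by (unfold dir; now rewrite cos_2PI, sin_2PI, cos_0, sin_0).
      transitivity ((A - (A - C) / eps ^ 2) * (/ m * (turning_angle m (2 * PI) - turning_angle m 0))
        + (A - C) / eps ^ 2 * (2 * PI)); [simpl; ring|].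
      rewrite turning_angle_2PI. replace (eps ^ 2) with (1 - m ^ 2) by lra.
      field. repeat split; nra. }
    apply (is_RInt_derive (V := R_CompleteNormedModule)).
    - intros t _. pose proof (kz_root_pos eps _ He (dir_neq_zero t)) as Hr.
      pose proof (dir_root_sqr eps t He) as Hs.
      pose proof (dir_turning_angle_derive eps t He) as Ht. fold m in Ht.
      pose proof (dir_root_derive eps t He) as Hd.
      assert (Hl : is_derive (fun t => ln (kz_root eps (dir t))) t
        (- eps ^ 2 * sin t * cos t / kz_root eps (dir t) * / kz_root eps (dir t))).
      { apply (is_derive_comp ln (fun t => kz_root eps (dir t))); [|exact Hd].
        now apply is_derive_ln. }
      pose proof (is_derive_scal _ _ (A - (A - C) / eps ^ 2) _ (is_derive_scal _ _ (/ m) _ Ht)) as H1.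
      pose proof (is_derive_scal _ _ ((A - C) / eps ^ 2) _ (is_derive_id t)) as H2.
      pose proof (is_derive_scal _ _ (B / eps ^ 2) _ Hl) as H3.
      pose proof (is_derive_minus _ _ _ _ _ (is_derive_plus _ _ _ _ _ H1 H2) H3) as H.
      match type of H with is_derive _ _ ?l => replace (_ / _) with l end; [exact H|].
      unfold Q, minus, plus, opp, one; simpl. rewrite cos_sqr_sin.
      set (r := kz_root eps (dir t)) in *. field_simplify_eq; [|repeat split; lra].
      replace (r ^ 2) with (1 - eps ^ 2 * (sin t * sin t)) by (rewrite <- Hs; ring). ring.
    - intros t _. now apply quotient_by_root_continuous. }
  assert (Hodd : is_RInt (fun t => eps * cos t * Q t / kz_root eps (dir t) ^ 3) 0 (2 * PI) 0).
  { apply is_RInt_half_turn_odd.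
    - intros t. apply quotient_by_root_continuous; [assumption|].
      apply (continuous_mult (fun t => eps * cos t) Q); [|apply HQ].
      apply (continuous_scal_r eps cos), continuous_cos.
    - intros t. unfold Q, kz_root, dir. simpl fst. simpl snd. rewrite neg_cos, neg_sin.
      replace ((- cos t) ^ 2 + (1 - eps ^ 2) * (- sin t) ^ 2)
        with (cos t ^ 2 + (1 - eps ^ 2) * sin t ^ 2) by ring. unfold Rdiv. ring. }
  pose proof (is_RInt_plus _ _ _ _ _ _ Heven Hodd) as H.
  change (is_RInt (fun t => Q t / kz_root eps (dir t) ^ 2
      + eps * cos t * Q t / kz_root eps (dir t) ^ 3) 0 (2 * PI)
    (2 * PI / (1 + m) * (A + C / m) + 0)) in H.
  rewrite Rplus_0_r in H. revert H. apply is_RInt_ext. intros t _.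
  pose proof (kz_root_pos eps _ He (dir_neq_zero t)) as Hr.
  pose proof (dir_root_sqr eps t He) as Hs. pose proof (kz_dir_pos eps t He) as HF.
  change (Q t / kz_root eps (dir t) ^ 2 + eps * cos t * Q t / kz_root eps (dir t) ^ 3
    = kz_density eps t * (Q t / kz_dir eps t ^ 2)).
  (* (r - eps cos t) (r + eps cos t) = 1 - eps ^ 2 for the root r. *)
  assert (Hinv : kz_dir eps t * (kz_root eps (dir t) + eps * cos t) = 1).
  { unfold kz_dir. apply (Rmult_eq_reg_l (1 - eps ^ 2)); [|lra].
    transitivity (kz_root eps (dir t) * kz_root eps (dir t) - eps ^ 2 * (cos t * cos t)).
    - field. lra.
    - rewrite Hs, cos_sqr_sin. ring. }
  unfold kz_density. set (r := kz_root eps (dir t)) in *. set (F := kz_dir eps t) in *.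
  transitivity (Q t / r ^ 3 * (r + eps * cos t)); [field; lra|].
  transitivity (Q t / r ^ 3 / F * (F * (r + eps * cos t))); [field; lra|].
  rewrite Hinv. field. lra.
Qed.

Lemma finsler_laplace_kz (eps : R) (f : R * R -> R) (p : R * R) :
  0 < eps < 1 -> smooth f ->
  finsler_laplace (katok_ziller eps) f p =
  2 * (1 - eps ^ 2) / (1 + sqrt (1 - eps ^ 2)) *
  (sqrt (1 - eps ^ 2) * D e1 (D e1 f) p + D e2 (D e2 f) p).
Proof.
  intros He Hf. destruct (sqrt_coef eps He) as [Hm Em].
  unfold finsler_laplace. rewrite (hilbert_form_kz eps He), (reeb_field_kz eps He).
  rewrite (fiber_integral_kz eps _ p He).
  pose proof (is_RInt_scal _ _ _ (sqrt (1 - eps ^ 2) ^ 3) _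
    (is_RInt_kz_quadratic eps (D e1 (D e1 f) p) (D e1 (D e2 f) p + D e2 (D e1 f) p)
       (D e2 (D e2 f) p) He)) as H.
  apply (is_RInt_ext _ (fun t => - a_t (scale_form (lie (kz_reeb eps) (lie (kz_reeb eps)
    (pull_fun f))) (angle_form (katok_ziller eps))) (p, t))) in H.
  - rewrite (is_RInt_unique _ _ _ _ H).
    unfold vol_S1.
    set (m := sqrt (1 - eps ^ 2)) in *. set (A := D e1 (D e1 f) p). set (C := D e2 (D e2 f) p).
    rewrite <- Em.
    change (2 / (2 * PI) * (m ^ 3 * (2 * PI / (1 + m) * (A + C / m)))
      = 2 * m ^ 2 / (1 + m) * (m * A + C)).
    pose proof PI_RGT_0. field. repeat split; lra.
  - intros t _. cbn [a_t scale_form]. rewrite (angle_form_kz eps p t He).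
    rewrite (lie2_kz_pull eps f p t Hf).
    unfold scal; simpl; unfold mult; simpl. ring.
Qed.

(** * Fourier coefficients and the spectrum *)

(** Allowing an arbitrary phase treats sine and cosine coefficients at once
    and makes the span of the family stable under products with
    [cos (2 * PI * x)]. *)
Definition mode (p : Z) (phi x : R) : R := cos (2 * PI * IZR p * x + phi).

Definition coef (g : R -> R) (p : Z) (phi : R) : R := RInt (fun x => g x * mode p phi x) 0 1.

Lemma cos_period_Z (x : R) (p : Z) : cos (x + 2 * PI * IZR p) = cos x.
Proof.
  assert (H : forall (y : R) (n : nat), cos (y + 2 * PI * IZR (Z.of_nat n)) = cos y).
  { intros y n. rewrite <- INR_IZR_INZ. rewrite <- (cos_period y n). f_equal. ring. }
  destruct (Z.le_ge_cases 0 p) as [Hp|Hp].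
  - rewrite <- (Z2Nat.id p Hp). apply H.
  - rewrite <- (H (x + 2 * PI * IZR p) (Z.to_nat (- p))).
    rewrite Z2Nat.id by lia. rewrite opp_IZR. f_equal. ring.
Qed.

Lemma mode_derive (p : Z) (phi x : R) :
  is_derive (mode p phi) x (- (2 * PI * IZR p * sin (2 * PI * IZR p * x + phi))).
Proof. unfold mode. auto_derive; [trivial | ring]. Qed.

Lemma mode_continuous (p : Z) (phi x : R) : continuous (mode p phi) x.
Proof.
  apply (ex_derive_continuous (V := R_NormedModule)). eexists. apply mode_derive.
Qed.

Lemma mode_continuous_mult (g : R -> R) (p : Z) (phi x : R) :
  continuous g x -> continuous (fun x => g x * mode p phi x) x.
Proof. intros H. apply (continuous_mult g); [exact H | apply mode_continuous]. Qed.

Lemma is_RInt_coef (g : R -> R) (p : Z) (phi : R) :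
  (forall x, continuous g x) -> is_RInt (fun x => g x * mode p phi x) 0 1 (coef g p phi).
Proof.
  intros Hg. apply (RInt_correct (V := R_CompleteNormedModule)), ex_RInt_continuous.
  intros x _. now apply mode_continuous_mult.
Qed.

(** With [c = cos (2 * PI * d)] this is [1 + cos (2 * PI * (x - 1 / 2)) - c]:
    at least 1 at distance at most [d] from [1 / 2], of absolute value at most 1
    on the rest of the period. *)
Definition kernel (c x : R) : R := 1 - cos (2 * PI * x) - c.

Lemma kernel_continuous (c x : R) : continuous (kernel c) x.
Proof.
  apply (ex_derive_continuous (V := R_NormedModule)). unfold kernel. auto_derive. trivial.
Qed.

Lemma kernel_pow_continuous (g : R -> R) (c : R) (n : nat) (x : R) :
  continuous g x -> continuous (fun x => g x * kernel c x ^ n) x.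
Proof.
  intros Hg. apply (continuous_mult g (fun x => kernel c x ^ n)); [exact Hg|].
  apply (continuous_comp (kernel c) (fun y => y ^ n)); [apply kernel_continuous|].
  apply (ex_derive_continuous (V := R_NormedModule)). auto_derive. trivial.
Qed.

(** Multiplying by the kernel shifts frequencies by one (product-to-sum), so
    functions with vanishing coefficients are stable under it. *)
Lemma coef_kernel_pow_eq_zero (g : R -> R) (c : R) (n : nat) :
  (forall x, continuous g x) -> (forall p phi, coef g p phi = 0) ->
  forall p phi, coef (fun x => g x * kernel c x ^ n) p phi = 0.
Proof.
  intros Hg H0. induction n as [|n IH]; intros p phi.
  - rewrite <- (H0 p phi). unfold coef. apply RInt_ext. intros x _.
    change (g x * 1 * mode p phi x = g x * mode p phi x). ring.
  - set (h := fun x => g x * kernel c x ^ n) in *.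
    assert (Hh : forall x, continuous h x) by (intros; now apply kernel_pow_continuous).
    pose proof (is_RInt_coef h p phi Hh) as H1.
    pose proof (is_RInt_coef h (p + 1) phi Hh) as H2.
    pose proof (is_RInt_coef h (p - 1) phi Hh) as H3.
    rewrite IH in H1, H2, H3.
    pose proof (is_RInt_plus _ _ _ _ _ _ (is_RInt_scal _ _ _ (1 - c) _ H1)
      (is_RInt_scal _ _ _ (- / 2) _ (is_RInt_plus _ _ _ _ _ _ H2 H3))) as H.
    apply (is_RInt_unique (V := R_CompleteNormedModule)).
    replace 0 with (plus (scal (1 - c) 0) (scal (- / 2) (plus 0 0))) at 2.
    2: { change ((1 - c) * 0 + - / 2 * (0 + 0) = 0). ring. }
    revert H. apply is_RInt_ext. intros x _.
    change ((1 - c) * (h x * mode p phi x)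
      + - / 2 * (h x * mode (p + 1) phi x + h x * mode (p - 1) phi x)
      = g x * (kernel c x * kernel c x ^ n) * mode p phi x).
    unfold h, mode. rewrite plus_IZR, minus_IZR.
    replace (2 * PI * (IZR p + 1) * x + phi) with (2 * PI * IZR p * x + phi + 2 * PI * x) by ring.
    replace (2 * PI * (IZR p - 1) * x + phi) with (2 * PI * IZR p * x + phi - 2 * PI * x) by ring.
    set (theta := 2 * PI * IZR p * x + phi).
    rewrite cos_plus, cos_minus. set (K := kernel c x ^ n). unfold kernel. field.
Qed.

Lemma kernel_moment_eq_zero (g : R -> R) (c : R) (n : nat) :
  (forall x, continuous g x) -> (forall p phi, coef g p phi = 0) ->
  is_RInt (fun x => g x * kernel c x ^ n) 0 1 0.
Proof.
  intros Hg H0.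
  pose proof (is_RInt_coef _ 0 0 (fun x => kernel_pow_continuous g c n x (Hg x))) as H.
  rewrite (coef_kernel_pow_eq_zero g c n Hg H0) in H.
  revert H. apply is_RInt_ext. intros x _.
  change (g x * kernel c x ^ n * mode 0 0 x = g x * kernel c x ^ n).
  unfold mode. replace (2 * PI * 0 * x + 0) with 0 by ring. rewrite cos_0. ring.
Qed.

Lemma cos_turn_opp (x : R) : cos (2 * PI * x) = - cos (2 * PI * (x - 1 / 2)).
Proof.
  replace (2 * PI * (x - 1 / 2)) with (2 * PI * x - PI) by field.
  rewrite cos_minus, cos_PI, sin_PI. ring.
Qed.

Lemma kernel_near (d x : R) :
  0 < d < 1 / 2 -> Rabs (x - 1 / 2) <= d -> 1 <= kernel (cos (2 * PI * d)) x.
Proof.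
  intros Hd Hx. unfold kernel. rewrite cos_turn_opp. pose proof PI_RGT_0.
  assert (cos (2 * PI * d) <= cos (2 * PI * (x - 1 / 2))); [|lra].
  assert (E : cos (2 * PI * (x - 1 / 2)) = cos (2 * PI * Rabs (x - 1 / 2))).
  { unfold Rabs. destruct (Rcase_abs (x - 1 / 2)); [|reflexivity].
    rewrite <- cos_neg. f_equal. ring. }
  rewrite E. pose proof (Rabs_pos (x - 1 / 2)). apply cos_decr_1; nra.
Qed.

Lemma kernel_far (d x : R) :
  0 < d < 1 / 2 -> 0 <= x <= 1 -> d <= Rabs (x - 1 / 2) ->
  Rabs (kernel (cos (2 * PI * d)) x) <= 1.
Proof.
  intros Hd Hx Hdx. unfold kernel. rewrite cos_turn_opp. pose proof PI_RGT_0.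
  assert (E : cos (2 * PI * (x - 1 / 2)) = cos (2 * PI * Rabs (x - 1 / 2))).
  { unfold Rabs. destruct (Rcase_abs (x - 1 / 2)); [|reflexivity].
    rewrite <- cos_neg. f_equal. ring. }
  assert (Rabs (x - 1 / 2) <= 1 / 2) by (apply Rabs_le; lra).
  assert (cos (2 * PI * (x - 1 / 2)) <= cos (2 * PI * d)).
  { rewrite E. apply cos_decr_1; nra. }
  pose proof (COS_bound (2 * PI * (x - 1 / 2))). pose proof (COS_bound (2 * PI * d)).
  apply Rabs_le. lra.
Qed.

(** Completeness of the trigonometric system, by concentration: powers of the
    kernel are bounded by 1 away from [1 / 2] and grow geometrically near it,
    so that the vanishing of all their moments rules out [g (1 / 2) > 0]. *)
Lemma coef_eq_zero_at_half_nonpos (g : R -> R) :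
  (forall x, continuous g x) -> (forall p phi, coef g p phi = 0) -> g (1 / 2) <= 0.
Proof.
  intros Hg H0. apply Rnot_lt_le. intros Hpos.
  set (c := g (1 / 2) / 2).
  assert (Hc : 0 < c) by (unfold c; lra).
  assert (Hnear : exists d, 0 < d < 1 / 2 /\ forall x, Rabs (x - 1 / 2) <= d -> c <= g x).
  { destruct (proj1 (filterlim_locally _ _) (Hg (1 / 2)) (mkposreal c Hc)) as [e He].
    exists (Rmin (e / 2) (1 / 4)). pose proof (cond_pos e).
    pose proof (Rmin_l (e / 2) (1 / 4)). pose proof (Rmin_r (e / 2) (1 / 4)).
    split; [split; [apply Rmin_pos; lra | lra]|].
    intros x Hx. assert (Hb : ball (1 / 2) e x) by (change (Rabs (x - 1 / 2) < e); lra).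
    pose proof (He x Hb) as Hb'. change (Rabs (g x - g (1 / 2)) < c) in Hb'.
    apply Rabs_def2 in Hb'. unfold c in *. lra. }
  destruct Hnear as [d [Hd Hgd]].
  assert (HM : exists M, forall x, 0 <= x <= 1 -> Rabs (g x) <= M).
  { destruct (continuity_ab_maj (fun x => Rabs (g x)) 0 1 Rle_0_1) as [x0 [Hx0 _]].
    - intros x _. apply continuity_pt_filterlim.
      apply (continuous_comp g Rabs); [apply Hg | apply continuous_Rabs].
    - now exists (Rabs (g x0)). }
  destruct HM as [M HM].
  set (T := kernel (cos (2 * PI * d))). set (tau := 1 + cos (PI * d) - cos (2 * PI * d)).
  pose proof PI_RGT_0 as HPI.
  (* tau is the value of T at distance d / 2 from the centre. *)
  assert (Htau : 1 < tau).
  { unfold tau. assert (cos (2 * PI * d) < cos (PI * d)) by (apply cos_decreasing_1; nra). lra. }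
  assert (HT : forall x, Rabs (x - 1 / 2) <= d / 2 -> tau <= T x).
  { intros x Hx. assert (Hd2 : 0 < d / 2 < 1 / 2) by lra.
    pose proof (kernel_near (d / 2) x Hd2 Hx) as H. unfold T, kernel, tau in *.
    replace (2 * PI * (d / 2)) with (PI * d) in H by field. lra. }
  assert (Hlow : forall n x, 0 <= x <= 1 -> - M <= g x * T x ^ n).
  { intros n x Hx. pose proof (HM x Hx) as Hgx.
    destruct (Rle_or_lt (Rabs (x - 1 / 2)) d) as [Hxd|Hxd].
    - pose proof (Hgd x Hxd). pose proof (kernel_near d x Hd Hxd) as H1. fold T in H1.
      pose proof (pow_R1_Rle (T x) n H1). pose proof (Rabs_pos (g x)). nra.
    - pose proof (kernel_far d x Hd Hx (Rlt_le _ _ Hxd)) as H1. fold T in H1.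
      assert (H2 : Rabs (g x * T x ^ n) <= M).
      { rewrite Rabs_mult, <- RPow_abs.
        assert (Rabs (T x) ^ n <= 1).
        { rewrite <- (pow1 n). apply pow_incr. split; [apply Rabs_pos | assumption]. }
        pose proof (Rabs_pos (g x)). pose proof (pow_le _ n (Rabs_pos (T x))). nra. }
      apply Rabs_le_between in H2. lra. }
  assert (Hbound : forall n, d * (c * tau ^ n) <= M).
  { intros n.
    assert (Hex : forall a b, ex_RInt (fun x => g x * T x ^ n) a b).
    { intros a b. apply (ex_RInt_continuous (V := R_CompleteNormedModule)).
      intros x _. now apply kernel_pow_continuous. }
    assert (Hpiece : forall a b l, a <= b -> (forall x, a < x < b -> l <= g x * T x ^ n) ->
      (b - a) * l <= RInt (fun x => g x * T x ^ n) a b).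
    { intros a b l Hab Hl.
      replace ((b - a) * l) with (RInt (fun _ => l) a b) by (rewrite RInt_const; reflexivity).
      apply RInt_le; auto. apply ex_RInt_const. }
    pose proof (is_RInt_unique _ _ _ _ (kernel_moment_eq_zero g (cos (2 * PI * d)) n Hg H0)) as Hz.
    change (RInt (fun x => g x * T x ^ n) 0 1 = 0) in Hz.
    pose proof (RInt_Chasles _ 0 (1 / 2 - d / 2) 1 (Hex _ _) (Hex _ _)) as C1.
    pose proof (RInt_Chasles _ (1 / 2 - d / 2) (1 / 2 + d / 2) 1 (Hex _ _) (Hex _ _)) as C2.
    rewrite Hz in C1. rewrite <- C2 in C1.
    pose proof (Hpiece 0 (1 / 2 - d / 2) (- M)) as P1.
    pose proof (Hpiece (1 / 2 - d / 2) (1 / 2 + d / 2) (c * tau ^ n)) as P2.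
    pose proof (Hpiece (1 / 2 + d / 2) 1 (- M)) as P3.
    unfold plus in C1; simpl in C1.
    assert (HM0 : 0 <= M).
    { apply Rle_trans with (Rabs (g 0)); [apply Rabs_pos | apply HM; lra]. }
    assert (Q1 : (1 / 2 - d / 2 - 0) * - M <= RInt (fun x => g x * T x ^ n) 0 (1 / 2 - d / 2)).
    { apply P1; [lra|]. intros x Hx. apply Hlow. lra. }
    assert (Q3 : (1 - (1 / 2 + d / 2)) * - M <= RInt (fun x => g x * T x ^ n) (1 / 2 + d / 2) 1).
    { apply P3; [lra|]. intros x Hx. apply Hlow. lra. }
    assert (Q2 : (1 / 2 + d / 2 - (1 / 2 - d / 2)) * (c * tau ^ n)
      <= RInt (fun x => g x * T x ^ n) (1 / 2 - d / 2) (1 / 2 + d / 2)).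
    { apply P2; [lra|]. intros x Hx.
      assert (Hxd : Rabs (x - 1 / 2) <= d / 2) by (apply Rabs_le; lra).
      pose proof (HT x Hxd). apply Rmult_le_compat; try lra.
      - apply pow_le. lra.
      - apply Hgd. lra.
      - apply pow_incr. lra. }
    nra. }
  destruct (Pow_x_infinity tau) with (b := M / (d * c) + 1) as [N HN].
  { rewrite Rabs_pos_eq; lra. }
  specialize (HN N (le_n N)). specialize (Hbound N).
  rewrite Rabs_pos_eq in HN by (apply pow_le; lra).
  assert (Hdc : 0 < d * c) by nra.
  assert (d * c * (M / (d * c) + 1) = M + d * c) by (field; lra).
  nra.
Qed.

Lemma coef_opp (g : R -> R) (p : Z) (phi : R) :
  (forall x, continuous g x) -> coef (fun x => - g x) p phi = - coef g p phi.
Proof.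
  intros Hg. apply (is_RInt_unique (V := R_CompleteNormedModule)).
  pose proof (is_RInt_opp _ _ _ _ (is_RInt_coef g p phi Hg)) as H.
  revert H. apply is_RInt_ext. intros x _.
  change (- (g x * mode p phi x) = - g x * mode p phi x). ring.
Qed.

Lemma RInt_period (h : R -> R) (a : R) :
  (forall x, continuous h x) -> (forall x, h (x + 1) = h x) ->
  RInt (fun x => h (x + a)) 0 1 = RInt h 0 1.
Proof.
  intros Hc Hp.
  assert (Hex : forall u v, ex_RInt h u v).
  { intros u v. apply (ex_RInt_continuous (V := R_CompleteNormedModule)). auto. }
  assert (Hshift : forall u v b, RInt (fun x => h (x + b)) u v = RInt h (u + b) (v + b)).
  { intros u v b. apply (is_RInt_unique (V := R_CompleteNormedModule)).
    pose proof (is_RInt_comp_lin h 1 b u v (RInt h (u + b) (v + b))) as H.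
    rewrite !Rmult_1_l in H.
    specialize (H (RInt_correct (V := R_CompleteNormedModule) _ _ _ (Hex _ _))).
    revert H. apply is_RInt_ext. intros x _.
    change (1 * h (1 * x + b) = h (x + b)). now rewrite !Rmult_1_l. }
  rewrite Hshift.
  pose proof (RInt_Chasles h (0 + a) 0 (1 + a) (Hex _ _) (Hex _ _)) as C1.
  pose proof (RInt_Chasles h 0 1 (1 + a) (Hex _ _) (Hex _ _)) as C2.
  pose proof (Hshift 0 a 1) as S.
  rewrite (RInt_ext _ h) in S by (intros; apply Hp).
  pose proof (opp_RInt_swap h 0 a (Hex _ _)) as W.
  unfold plus, opp in *; simpl in *.
  rewrite <- C1, <- C2. replace (0 + a) with a by ring. rewrite <- W.
  replace (1 + a) with (a + 1) by ring. replace (0 + 1) with 1 in S by ring. rewrite <- S.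
  change (- RInt h 0 a + (RInt h 0 1 + RInt h 0 a) = RInt h 0 1). ring.
Qed.

Lemma mode_period (p : Z) (phi x : R) : mode p phi (x + 1) = mode p phi x.
Proof.
  unfold mode. rewrite <- (cos_period_Z (2 * PI * IZR p * x + phi) p). f_equal. ring.
Qed.

(** A translation brings any point to [1 / 2]; it only changes phases. *)
Lemma coef_eq_zero (g : R -> R) :
  (forall x, continuous g x) -> (forall x, g (x + 1) = g x) ->
  (forall p phi, coef g p phi = 0) -> forall x, g x = 0.
Proof.
  intros Hg Hp H0 x.
  set (h := fun y => g (y + (x - 1 / 2))).
  assert (Hh : forall y, continuous h y).
  { intros y. apply (continuous_comp (fun y => y + (x - 1 / 2)) g); [|apply Hg].
    apply (ex_derive_continuous (V := R_NormedModule)). auto_derive. trivial. }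
  assert (Hz : forall p phi, coef h p phi = 0).
  { intros p phi. rewrite <- (H0 p (phi - 2 * PI * IZR p * (x - 1 / 2))).
    set (psi := phi - 2 * PI * IZR p * (x - 1 / 2)).
    unfold coef. rewrite <- (RInt_period (fun y => g y * mode p psi y) (x - 1 / 2)).
    - apply RInt_ext. intros y _. unfold h, mode, psi. do 2 f_equal. ring.
    - intros y. now apply mode_continuous_mult.
    - intros y. now rewrite Hp, mode_period. }
  assert (E : h (1 / 2) = g x) by (unfold h; f_equal; ring).
  pose proof (coef_eq_zero_at_half_nonpos h Hh Hz) as H1.
  pose proof (coef_eq_zero_at_half_nonpos (fun y => - h y)) as H2. cbv beta in H2.
  enough (- h (1 / 2) <= 0) by lra. apply H2.
  - intros y. apply (continuous_opp h), Hh.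
  - intros p phi. rewrite coef_opp, Hz by assumption. ring.
Qed.

(** Two integrations by parts, done at once: the difference of the two
    integrands is the derivative of [P], which agrees at [0] and [1]. *)
Lemma coef_second_derivative (g g' g'' : R -> R) (p : Z) (phi : R) :
  (forall x, is_derive g x (g' x)) -> (forall x, is_derive g' x (g'' x)) ->
  (forall x, continuous g'' x) -> g 1 = g 0 -> g' 1 = g' 0 ->
  coef g'' p phi = - (2 * PI * IZR p) ^ 2 * coef g p phi.
Proof.
  intros D1 D2 Hc P0 P1. set (w := 2 * PI * IZR p).
  assert (Hg : forall x, continuous g x).
  { intros x. apply (ex_derive_continuous (V := R_NormedModule)). eexists. apply D1. }
  set (P := fun x => g' x * cos (w * x + phi) + w * (g x * sin (w * x + phi))).
  assert (HP : forall x, is_derive P x (g'' x * mode p phi x + w ^ 2 * (g x * mode p phi x))).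
  { intros x.
    assert (Dc : is_derive (fun x => cos (w * x + phi)) x (- (w * sin (w * x + phi))))
      by (auto_derive; [trivial | ring]).
    assert (Ds : is_derive (fun x => sin (w * x + phi)) x (w * cos (w * x + phi)))
      by (auto_derive; [trivial | ring]).
    pose proof (is_derive_mult _ _ _ _ _ (D2 x) Dc Rmult_comm) as H1.
    pose proof (is_derive_scal _ _ w _ (is_derive_mult _ _ _ _ _ (D1 x) Ds Rmult_comm)) as H2.
    pose proof (is_derive_plus _ _ _ _ _ H1 H2) as H.
    unfold plus, mult in H; simpl in H. unfold mode. fold w.
    match type of H with is_derive _ _ ?l => replace (_ + _) with l end; [exact H|].
    unfold plus, mult; simpl. ring. }
  assert (E : minus (P 1) (P 0) = 0).
  { change (P 1 - P 0 = 0). unfold P. rewrite P0, P1.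
    pose proof (mode_period p phi 0) as Hm. unfold mode in Hm. fold w in Hm.
    pose proof (mode_period p (phi - PI / 2) 0) as Hs. unfold mode in Hs. fold w in Hs.
    rewrite Rplus_0_l in Hm, Hs. rewrite Hm.
    replace (w * 1 + (phi - PI / 2)) with (w * 1 + phi - PI / 2) in Hs by ring.
    replace (w * 0 + (phi - PI / 2)) with (w * 0 + phi - PI / 2) in Hs by ring.
    rewrite !cos_minus, cos_PI2, sin_PI2 in Hs.
    replace (sin (w * 1 + phi)) with (sin (w * 0 + phi)) by lra. ring. }
  assert (H : is_RInt (fun x => g'' x * mode p phi x + w ^ 2 * (g x * mode p phi x)) 0 1
    (minus (P 1) (P 0))).
  { apply (is_RInt_derive (V := R_CompleteNormedModule)); intros x _; [apply HP|].
    apply (continuous_plus (fun x => g'' x * mode p phi x)).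
    - now apply mode_continuous_mult.
    - apply (continuous_scal_r (w ^ 2) (fun x => g x * mode p phi x)). now apply mode_continuous_mult. }
  rewrite E in H.
  pose proof (is_RInt_plus _ _ _ _ _ _ (is_RInt_coef g'' p phi Hc)
    (is_RInt_scal _ _ _ (w ^ 2) _ (is_RInt_coef g p phi Hg))) as H'.
  pose proof (eq_trans (eq_sym (is_RInt_unique (V := R_CompleteNormedModule) _ _ _ _ H))
    (is_RInt_unique (V := R_CompleteNormedModule) _ _ _ _ H')) as Hf.
  change (0 = coef g'' p phi + w ^ 2 * coef g p phi) in Hf. lra.
Qed.

Lemma smooth_D (v : R * R) (f : R * R -> R) : smooth f -> smooth (D v f).
Proof.
  intros Hf vs p Hp.
  assert (E : iterD vs (D v f) = iterD (vs ++ v :: nil) f).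
  { unfold iterD. now rewrite fold_right_app. }
  rewrite E. now apply Hf.
Qed.

Lemma torus_smooth_D (v : R * R) (f : R * R -> R) : torus_smooth f -> torus_smooth (D v f).
Proof.
  intros [Hp Hs]. split; [|now apply smooth_D].
  intros x y. destruct v as [a b]. unfold D. split; apply Derive_ext; intros s.
  - change (f (x + 1 + s * a, y + s * b) = f (x + s * a, y + s * b)).
    replace (x + 1 + s * a) with (x + s * a + 1) by ring. apply Hp.
  - change (f (x + s * a, y + 1 + s * b) = f (x + s * a, y + s * b)).
    replace (y + 1 + s * b) with (y + s * b + 1) by ring. apply Hp.
Qed.

Lemma torus_smooth_continuous (f : R * R -> R) (p : R * R) : torus_smooth f -> continuous f p.
Proof. intros [_ Hs]. now apply (Hs nil p). Qed.

Lemma is_derive_D_x (f : R * R -> R) (x y : R) :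
  torus_smooth f -> is_derive (fun x => f (x, y)) x (D e1 f (x, y)).
Proof.
  intros [_ Hs].
  pose proof (Derive_correct _ _ (proj2 (Hs nil (x, y) I) e1)) as H.
  assert (H' : is_derive (fun s => f (x + s * 1, y + s * 0)) (x - x) (D e1 f (x, y))).
  { rewrite Rminus_diag. exact H. }
  apply (is_derive_ext (fun z : R => f (x + (z - x) * 1, y + (z - x) * 0))).
  { intros z. change R in z. replace (x + (z - x) * 1) with z by ring.
    replace (y + (z - x) * 0) with y by ring. reflexivity. }
  replace (D e1 f (x, y)) with (scal 1 (D e1 f (x, y))) by apply (scal_one (D e1 f (x, y))).
  apply (is_derive_comp (fun s => f (x + s * 1, y + s * 0)) (fun z => z - x)); [exact H'|].
  auto_derive; [trivial | ring].
Qed.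

Lemma is_derive_D_y (f : R * R -> R) (x y : R) :
  torus_smooth f -> is_derive (fun y => f (x, y)) y (D e2 f (x, y)).
Proof.
  intros [_ Hs].
  pose proof (Derive_correct _ _ (proj2 (Hs nil (x, y) I) e2)) as H.
  assert (H' : is_derive (fun s => f (x + s * 0, y + s * 1)) (y - y) (D e2 f (x, y))).
  { rewrite Rminus_diag. exact H. }
  apply (is_derive_ext (fun z : R => f (x + (z - y) * 0, y + (z - y) * 1))).
  { intros z. change R in z. replace (x + (z - y) * 0) with x by ring.
    replace (y + (z - y) * 1) with z by ring. reflexivity. }
  replace (D e2 f (x, y)) with (scal 1 (D e2 f (x, y))) by apply (scal_one (D e2 f (x, y))).
  apply (is_derive_comp (fun s => f (x + s * 0, y + s * 1)) (fun z => z - y)); [exact H'|].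
  auto_derive; [trivial | ring].
Qed.

Lemma slice_x_continuous (f : R * R -> R) (x y : R) :
  torus_smooth f -> continuous (fun x => f (x, y)) x.
Proof.
  intros Hf. apply (ex_derive_continuous (V := R_NormedModule)). eexists. now apply is_derive_D_x.
Qed.

(** Fourier coefficients on the torus are taken one variable at a time, so that
    completeness and integration by parts are needed on the circle only. *)
Definition partial_coef (f : R * R -> R) (p : Z) (phi y : R) : R :=
  coef (fun x => f (x, y)) p phi.

Lemma is_derive_RInt_continuous (f g : R -> R -> R) (a b y : R) :
  (forall u t, is_derive (fun u => f u t) u (g u t)) ->
  (forall z : R * R, continuous (fun z : R * R => g (fst z) (snd z)) z) ->
  (forall u, ex_RInt (f u) a b) ->
  is_derive (fun u => RInt (f u) a b) y (RInt (g y) a b).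
Proof.
  intros Hd Hc Hi.
  assert (E : forall u t, Derive (fun u => f u t) u = g u t).
  { intros u t. apply is_derive_unique, Hd. }
  rewrite <- (RInt_ext (fun t => Derive (fun u => f u t) y) (g y)) by (intros; apply E).
  apply is_derive_RInt_param.
  - apply filter_forall. intros u t _. eexists. apply Hd.
  - intros t _. apply (continuity_2d_pt_ext g); [intros; symmetry; apply E|].
    apply continuity_2d_pt_filterlim, (Hc (y, t)).
  - apply filter_forall. exact Hi.
Qed.

Lemma partial_coef_derive (f : R * R -> R) (p : Z) (phi y : R) :
  torus_smooth f -> is_derive (partial_coef f p phi) y (partial_coef (D e2 f) p phi y).
Proof.
  intros Hf.
  apply (is_derive_RInt_continuous (fun y x => f (x, y) * mode p phi x)
    (fun y x => D e2 f (x, y) * mode p phi x)).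
  - intros z x. pose proof (is_derive_scal _ _ (mode p phi x) _ (is_derive_D_y f x z Hf)) as H.
    rewrite Rmult_comm. revert H. apply is_derive_ext. intros t. apply Rmult_comm.
  - intros z. pose proof (torus_smooth_D e2 f Hf) as Hg. revert Hg.
    generalize (D e2 f). intros g Hg.
    apply (continuous_mult (fun z : R * R => g (snd z, fst z)) (fun z => mode p phi (snd z))).
    + apply (continuous_comp_2 snd fst (fun x y => g (x, y))).
      * apply continuous_snd.
      * apply continuous_fst.
      * apply (continuous_ext g); [now intros [a b]|]. now apply torus_smooth_continuous.
    + apply (continuous_comp snd (mode p phi)); [apply continuous_snd | apply mode_continuous].
  - intros z. eexists. apply is_RInt_coef. intros x. now apply slice_x_continuous.
Qed.

Lemma partial_coef_continuous (f : R * R -> R) (p : Z) (phi y : R) :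
  torus_smooth f -> continuous (partial_coef f p phi) y.
Proof.
  intros Hf. apply (ex_derive_continuous (V := R_NormedModule)).
  eexists. now apply partial_coef_derive.
Qed.

Lemma partial_coef_period (f : R * R -> R) (p : Z) (phi y : R) :
  torus_periodic f -> partial_coef f p phi (y + 1) = partial_coef f p phi y.
Proof.
  intros Hf. apply RInt_ext. intros x _. f_equal. apply Hf.
Qed.

Lemma partial_coef_D_x (f : R * R -> R) (p : Z) (phi y : R) :
  torus_smooth f ->
  partial_coef (D e1 (D e1 f)) p phi y = - (2 * PI * IZR p) ^ 2 * partial_coef f p phi y.
Proof.
  intros Hf. pose proof (torus_smooth_D e1 f Hf) as H1.
  pose proof (torus_smooth_D e1 _ H1) as H2.
  assert (P : forall g, torus_smooth g -> g (1, y) = g (0, y)).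
  { intros g [Hg _]. rewrite <- (Rplus_0_l 1). apply Hg. }
  apply (coef_second_derivative (fun x => f (x, y)) (fun x => D e1 f (x, y))).
  - intros x. now apply is_derive_D_x.
  - intros x. now apply is_derive_D_x.
  - intros x. now apply slice_x_continuous.
  - now apply P.
  - now apply P.
Qed.

Lemma partial_coef_D_y (f : R * R -> R) (p q : Z) (phi psi : R) :
  torus_smooth f ->
  coef (partial_coef (D e2 (D e2 f)) p phi) q psi
  = - (2 * PI * IZR q) ^ 2 * coef (partial_coef f p phi) q psi.
Proof.
  intros Hf. pose proof (torus_smooth_D e2 f Hf) as H1.
  pose proof (torus_smooth_D e2 _ H1) as H2.
  assert (P : forall g, torus_smooth g -> partial_coef g p phi 1 = partial_coef g p phi 0).
  { intros g [Hg _]. rewrite <- (Rplus_0_l 1). now apply partial_coef_period. }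
  apply (coef_second_derivative _ (partial_coef (D e2 f) p phi)).
  - intros x. now apply partial_coef_derive.
  - intros x. now apply partial_coef_derive.
  - intros x. now apply partial_coef_continuous.
  - now apply P.
  - now apply P.
Qed.

Lemma exists_nonzero_coef (f : R * R -> R) :
  torus_smooth f -> (exists z, f z <> 0) ->
  exists p q phi psi, coef (partial_coef f p phi) q psi <> 0.
Proof.
  intros Hf [[x y] Hxy]. apply NNPP. intros Hn. apply Hxy.
  assert (H0 : forall p phi y, partial_coef f p phi y = 0).
  { intros p phi. apply coef_eq_zero.
    - intros z. now apply partial_coef_continuous.
    - intros z. apply partial_coef_period, Hf.
    - intros q psi. apply NNPP. intros H. apply Hn. now exists p, q, phi, psi. }
  apply (coef_eq_zero (fun x => f (x, y))).
  - intros z. now apply slice_x_continuous.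
  - intros z. apply Hf.
  - intros p phi. apply H0.
Qed.

Lemma coef_linear (f g : R -> R) (a b : R) (p : Z) (phi : R) :
  (forall x, continuous f x) -> (forall x, continuous g x) ->
  coef (fun x => a * f x + b * g x) p phi = a * coef f p phi + b * coef g p phi.
Proof.
  intros Hf Hg. apply (is_RInt_unique (V := R_CompleteNormedModule)).
  pose proof (is_RInt_plus _ _ _ _ _ _ (is_RInt_scal _ _ _ a _ (is_RInt_coef f p phi Hf))
    (is_RInt_scal _ _ _ b _ (is_RInt_coef g p phi Hg))) as H.
  revert H. apply is_RInt_ext. intros x _.
  change (a * (f x * mode p phi x) + b * (g x * mode p phi x)
    = (a * f x + b * g x) * mode p phi x). ring.
Qed.

(** Some Fourier coefficient of an eigenfunction is nonzero, and on it the
    operator acts by multiplication by minus the asserted number. *)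
Lemma flat_eigenvalue (a b lambda : R) (f : R * R -> R) :
  torus_smooth f -> (exists z, f z <> 0) ->
  (forall z, a * D e1 (D e1 f) z + b * D e2 (D e2 f) z + lambda * f z = 0) ->
  exists p q : Z, lambda = 4 * PI ^ 2 * (a * IZR p ^ 2 + b * IZR q ^ 2).
Proof.
  intros Hf Hz He. destruct (exists_nonzero_coef f Hf Hz) as [p [q [phi [psi Hc]]]].
  exists p, q.
  pose proof (torus_smooth_D e1 _ (torus_smooth_D e1 _ Hf)) as Hxx.
  pose proof (torus_smooth_D e2 _ (torus_smooth_D e2 _ Hf)) as Hyy.
  assert (E1 : forall y, b * partial_coef (D e2 (D e2 f)) p phi y
    + (lambda - a * (2 * PI * IZR p) ^ 2) * partial_coef f p phi y = 0).
  { intros y.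
    assert (E : a * partial_coef (D e1 (D e1 f)) p phi y
      + lambda * partial_coef f p phi y = - b * partial_coef (D e2 (D e2 f)) p phi y
      + 0 * partial_coef f p phi y).
    { unfold partial_coef. rewrite <- !coef_linear by (intros; now apply slice_x_continuous).
      apply RInt_ext. intros x _. f_equal. pose proof (He (x, y)). lra. }
    rewrite (partial_coef_D_x f p phi y Hf) in E. lra. }
  assert (E2 : b * coef (partial_coef (D e2 (D e2 f)) p phi) q psi
    + (lambda - a * (2 * PI * IZR p) ^ 2) * coef (partial_coef f p phi) q psi = 0).
  { rewrite <- coef_linear by (intros; now apply partial_coef_continuous).
    unfold coef at 1. rewrite (RInt_ext _ (fun _ => 0)).
    - rewrite RInt_const. apply Rmult_0_r.
    - intros y _. rewrite E1. apply Rmult_0_l. }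
  rewrite (partial_coef_D_y f p q phi psi Hf) in E2.
  apply (Rmult_eq_reg_r (coef (partial_coef f p phi) q psi)); [|assumption].
  lra.
Qed.

Definition torus_mode (p q : Z) (phi : R) (z : R * R) : R :=
  cos (2 * PI * IZR p * fst z + 2 * PI * IZR q * snd z + phi).

Lemma torus_mode_smooth (p q : Z) (phi : R) : torus_smooth (torus_mode p q phi).
Proof.
  split.
  - intros x y. unfold torus_mode. simpl fst. simpl snd. split.
    + rewrite <- (cos_period_Z (2 * PI * IZR p * x + _ + phi) p). f_equal. ring.
    + rewrite <- (cos_period_Z (2 * PI * IZR p * x + 2 * PI * IZR q * y + phi) q). f_equal. ring.
  - apply elementary_smooth, elem_cos, elem_plus; [|apply elem_const].
    apply elem_plus; apply elem_mult; try apply elem_const; apply elem_linear;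
      [apply is_linear_fst | apply is_linear_snd].
Qed.

(** Differentiating a cosine advances its phase by a quarter turn. *)
Lemma torus_mode_D (p q : Z) (phi : R) (z v : R * R) :
  D v (torus_mode p q phi) z
  = 2 * PI * (IZR p * fst v + IZR q * snd v) * torus_mode p q (phi + PI / 2) z.
Proof.
  destruct z as [x y], v as [a b]. apply is_derive_unique.
  apply (is_derive_ext (fun s =>
    cos (2 * PI * IZR p * (x + s * a) + 2 * PI * IZR q * (y + s * b) + phi))); [reflexivity|].
  unfold torus_mode. simpl fst. simpl snd. auto_derive; [trivial|].
  replace (2 * PI * IZR p * x + 2 * PI * IZR q * y + (phi + PI / 2))
    with (PI / 2 + (2 * PI * IZR p * x + 2 * PI * IZR q * y + phi)) by ring.
  rewrite <- (Ropp_involutive (cos (PI / 2 + _))), <- sin_cos.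
  rewrite !Rmult_0_l, !Rplus_0_r. ring.
Qed.

Lemma torus_mode_D2 (p q : Z) (phi : R) (z v : R * R) :
  D v (D v (torus_mode p q phi)) z
  = - (2 * PI * (IZR p * fst v + IZR q * snd v)) ^ 2 * torus_mode p q phi z.
Proof.
  set (k := 2 * PI * (IZR p * fst v + IZR q * snd v)).
  transitivity (k * D v (torus_mode p q (phi + PI / 2)) z).
  - unfold D at 1. rewrite (Derive_ext _ (fun s => k * torus_mode p q (phi + PI / 2) (plus z (scal s v)))).
    + apply Derive_scal.
    + intros s. apply torus_mode_D.
  - rewrite torus_mode_D. fold k. unfold torus_mode.
    replace (2 * PI * IZR p * fst z + 2 * PI * IZR q * snd z + (phi + PI / 2 + PI / 2))
      with (2 * PI * IZR p * fst z + 2 * PI * IZR q * snd z + phi + PI) by field.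
    rewrite neg_cos. ring.
Qed.

Theorem theorem5p6 (eps : R) (heps : 0 < eps < 1) :
  is_finsler (katok_ziller eps) /\
  (forall f : R * R -> R, torus_smooth f -> forall p : R * R,
     finsler_laplace (katok_ziller eps) f p =
     2 * (1 - eps ^ 2) / (1 + sqrt (1 - eps ^ 2)) *
     (sqrt (1 - eps ^ 2) * D e1 (D e1 f) p + D e2 (D e2 f) p)) /\
  (forall lambda : R,
     spectrum (katok_ziller eps) lambda <->
     exists p q : Z,
       lambda = 4 * PI ^ 2 * (2 * (1 - eps ^ 2) / (1 + sqrt (1 - eps ^ 2))) *
                (sqrt (1 - eps ^ 2) * IZR p ^ 2 + IZR q ^ 2)).
Proof.
  split; [now apply kz_is_finsler|].
  assert (HL : forall f : R * R -> R, torus_smooth f -> forall p : R * R,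
     finsler_laplace (katok_ziller eps) f p =
     2 * (1 - eps ^ 2) / (1 + sqrt (1 - eps ^ 2)) *
     (sqrt (1 - eps ^ 2) * D e1 (D e1 f) p + D e2 (D e2 f) p)).
  { intros f [_ Hf] p. now apply finsler_laplace_kz. }
  split; [exact HL|].
  set (c := 2 * (1 - eps ^ 2) / (1 + sqrt (1 - eps ^ 2))) in *.
  set (m := sqrt (1 - eps ^ 2)) in *.
  intros lambda. split.
  - intros [f [Hf [Hz He]]].
    destruct (flat_eigenvalue (c * m) c lambda f Hf Hz) as [p [q E]].
    + intros z. rewrite <- (He z), (HL f Hf). ring.
    + exists p, q. rewrite E. ring.
  - intros [p [q E]]. exists (torus_mode p q 0).
    split; [apply torus_mode_smooth|]. split.
    + exists (0, 0). unfold torus_mode. simpl fst. simpl snd.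
      rewrite !Rmult_0_r, !Rplus_0_r, cos_0. lra.
    + intros z. rewrite (HL _ (torus_mode_smooth p q 0)), !torus_mode_D2, E.
      unfold e1, e2. simpl fst. simpl snd. ring.
Qed.
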